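(* On $\mathbb T^4$ with coordinates $x^0,\dots,x^3$ let $\omega_1=dx^{01}+dx^{23}$, $\omega_2=dx^{02}+dx^{31}$, $\omega_3=u\,dx^{03}+dx^{12}$ with $u=u(x_0,x_3,t)>0$ smooth, and let $\varphi(t)=d\theta^{123}-\sum_id\theta^i\wedge\omega_i$ be the corresponding path of closed $G_2$-structures on $M=\mathbb T^3\times\mathbb T^4$. Let $\alpha(t)$ be $1$-forms on $\mathbb T^4$ with $\partial_t\omega_3=d\alpha$, solving the $L^2$ geodesic equation $$6\alpha_t=2i_{\alpha^\sharp}A_3^\alpha+u^{2/3}\delta\big[*_4(u^{-2/3}i_{\alpha^\sharp}\omega_1\wedge i_{\alpha^\sharp}\omega_2)\big]-2u^{2/3}\delta\big[\alpha\wedge*_4(u^{-2/3}i_{\alpha^\sharp}\omega_1\wedge\omega_2)\big],$$ and suppose that $\alpha=\sum_i\alpha_idx^i$ has the normalisation $\alpha_0=\alpha_1=\alpha_2=0$, $\partial_0\alpha_3=f$, where $f=\partial_tu$. Then the volume $\mathrm{Vol}(\varphi(t))=\int_M\mathrm{vol}_\varphi$ is concave along this geodesic: $$9\,\mathrm{Vol}_{tt}=-2\int_M\big[u^{-1}f-u^{-2}u_0\alpha_3\big]^2\mathrm{vol}_\varphi=-2\int_M\Big[\partial_0\Big(\frac{\alpha_3}u\Big)\Big]^2\mathrm{vol}_\varphi ,\qquad u_0=\partial_{x_0}u.$$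
   Context: Here $\mathrm{vol}_0=dx^{0123}$, $\mathrm{vol}_\varphi=u^{1/3}dx^{0123}\wedge d\theta^{123}$, and the metric on $\mathbb T^4$ is $g_4=\mathrm{diag}(u^{2/3},u^{-1/3},u^{-1/3},u^{2/3})$ with orientation $dx^{0123}$, Hodge star $*_4$ and musical isomorphism $\sharp$; on $2$-forms of $\mathbb T^4$ the convention is $\delta=*_4d*_4$. For vectors $x,y$, $A_3^\alpha$ is the symmetric $2$-tensor $$A_3^\alpha(x,y)=\frac1{u^{1/3}\mathrm{vol}_0}\big[i_xd\alpha\wedge i_y\omega_1\wedge\omega_2+i_yd\alpha\wedge i_x\omega_1\wedge\omega_2+d\alpha\wedge\tfrac12(i_x\omega_1\wedge i_y\omega_2-i_x\omega_2\wedge i_y\omega_1)\big],$$ and $i_{\alpha^\sharp}A_3^\alpha=A_3^\alpha(\alpha^\sharp,\cdot)$. *)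

(* Defs.v *)
From HB Require Import structures.
From mathcomp Require Import all_boot all_order all_algebra.
From mathcomp Require Import all_classical all_reals all_analysis.
From mathcomp Require Import ring lra.

Set Implicit Arguments.
Unset Strict Implicit.
Unset Printing Implicit Defensive.

Import Order.TTheory GRing.Theory Num.Theory.
Import numFieldNormedType.Exports.
Local Open Scope ring_scope.
Local Open Scope classical_set_scope.

(* [a : ext R n] is the element of the exterior algebra of R^n whose
   coefficient on dx^{i_1} /\ ... /\ dx^{i_k}, i_1 < ... < i_k, is
   [a [set i_1; ...; i_k]]. *)
Notation ext R n := {ffun {set 'I_n} -> R^o}.

(* The torus T^n is (R/Z)^n: a form on T^n is a form on R^n whose coefficients
   satisfy [torus_periodic] below. *)
Notation diff_form R n := ('rV[R]_n -> ext R n).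

Definition base (R : realType) n (I : {set 'I_n}) : ext R n :=
  [ffun J => (J == I)%:R].

Definition dx (R : realType) n (i : 'I_n) : ext R n := base R [set i]%SET.

(* dx^I /\ dx^J = sgn I J dx^(I u J) for disjoint I and J. *)
Definition sgn (R : realType) n (I J : {set 'I_n}) : R :=
  (-1) ^+ #|[set p : 'I_n * 'I_n | [&& p.1 \in I, p.2 \in J & (p.2 < p.1)%N]]%SET|.

Definition wedge (R : realType) n (a b : ext R n) : ext R n :=
  [ffun K : {set 'I_n} => \sum_(I : {set 'I_n} | I \subset K)
     sgn R I (K :\: I)%SET * a I * b (K :\: I)%SET].

Notation "a \wedge b" := (wedge a b) (at level 40, left associativity).

(* The contraction i_v a. *)
Definition iprod (R : realType) n (v : 'rV[R]_n) (a : ext R n) : ext R n :=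
  [ffun K : {set 'I_n} => \sum_(i | i \notin K)
     v 0 i * sgn R [set i]%SET K * a (i |: K)%SET].

Definition evec (R : realType) n (i : 'I_n) : 'rV[R]_n := delta_mx 0 i.

(* The coefficient with respect to dx^1 /\ ... /\ dx^n. *)
Definition top (R : realType) n (a : ext R n) : R := a [set: 'I_n]%SET.

Definition homogeneous (R : realType) n k (a : ext R n) : Prop :=
  forall I : {set 'I_n}, #|I| != k -> a I = 0.

Definition pderiv (R : realType) n (i : 'I_n) (f : 'rV[R]_n -> R)
  (x : 'rV[R]_n) : R := 'D_(evec R i) f x.

Definition ext_deriv (R : realType) n (a : diff_form R n) : diff_form R n :=
  fun x =>
  \sum_(i < n) dx R i \wedge [ffun I => pderiv i (fun y => a y I) x].

(* Time derivatives, at fixed x. *)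
Definition dt_fun (R : realType) n (u : R -> 'rV[R]_n -> R) (t : R)
  (x : 'rV[R]_n) : R := derive1 (fun s => u s x) t.

Definition dt (R : realType) n (a : R -> diff_form R n) (t : R)
  : diff_form R n :=
  fun x => [ffun I => dt_fun (fun s y => a s y I) t x].

(* The i-th component of a 1-form. *)
Definition component (R : realType) n (i : 'I_n) (a : diff_form R n)
  : 'rV[R]_n -> R := fun x => a x [set i]%SET.

(* All the metrics below are diagonal in the frame of the coordinate vector
   fields; they are given by the row [g] of their diagonal entries. *)
Definition sharp (R : realType) n (g : 'rV[R]_n) (a : ext R n) : 'rV[R]_n :=
  \row_i ((g 0 i)^-1 * a [set i]%SET).

(* b /\ star c = <b, c>_g vol_g, where vol_g = sqrt (det g) dx^{1...n} and
   the dx^I are orthogonal with <dx^I, dx^I>_g = \prod_(i in I) g_ii^-1. *)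
Definition hodge (R : realType) n (g : 'rV[R]_n) (a : ext R n) : ext R n :=
  \sum_(I : {set 'I_n})
    (Num.sqrt (\prod_i g 0 i) * (\prod_(i in I) (g 0 i)^-1)
       * sgn R I (~: I)%SET * a I) *: base R (~: I)%SET.

Definition hodge_form (R : realType) n (g : 'rV[R]_n -> 'rV[R]_n)
  (a : diff_form R n) : diff_form R n := fun x => hodge (g x) (a x).

(* The codifferential on 2-forms in dimension 4, with the sign convention
   delta = * d *. *)
Definition codiff (R : realType) (g : 'rV[R]_4 -> 'rV[R]_4) (a : diff_form R 4)
  : diff_form R 4 := hodge_form g (ext_deriv (hodge_form g a)).

Definition torus_periodic (R : realType) n (f : 'rV[R]_n -> R) : Prop :=
  forall x i, f (x + evec R i) = f x.

(* For an open set A of a finite-dimensional space: f is C^k on A. *)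
Fixpoint Ck_on (R : realType) (V : normedModType R) (k : nat) (A : set V)
  (f : V -> R) : Prop :=
  match k with
  | 0 => forall x, A x -> {for x, continuous f}
  | k'.+1 => (forall x, A x -> differentiable f x) /\
             (forall v, Ck_on k' A (fun x => 'D_v f x))
  end.

Definition smooth_on (R : realType) (V : normedModType R) (A : set V)
  (f : V -> R) : Prop := forall k, Ck_on k A f.

Definition smooth_path (R : realType) n (J : set R)
  (f : R -> 'rV[R]_n -> R) : Prop :=
  smooth_on [set p : R^o * 'rV[R]_n | J p.1] (fun p => f p.1 p.2).

(* The integral over [0, 1]^n, as an iterated integral. *)
Fixpoint cube_int (R : realType) (n : nat) : ('rV[R]_n -> R) -> R :=
  match n with
  | 0 => fun f => f 0
  | m.+1 => fun f => \int[lebesgue_measure]_(s in `[0, 1])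
      cube_int (fun y : 'rV[R]_m => f (row_mx (s%:M : 'rV[R]_1) y))
  end.

(* The integral of a top-degree form over T^n. *)
Definition torus_int (R : realType) n (a : diff_form R n) : R :=
  cube_int (fun x => top (a x)).

(* The hypersymplectic triple on T^4, with coordinates x^0, ..., x^3. *)

Definition omega1 (R : realType) : ext R 4 :=
  dx R 0 \wedge dx R 1 + dx R 2 \wedge dx R 3.

Definition omega2 (R : realType) : ext R 4 :=
  dx R 0 \wedge dx R 2 + dx R 3 \wedge dx R 1.

Definition omega3 (R : realType) (u : R) : ext R 4 :=
  u *: (dx R 0 \wedge dx R 3) + dx R 1 \wedge dx R 2.

(* The points of M = T^3 x T^4 are written (x^0, ..., x^3, th^1, th^2, th^3),
   so that dx^{0123} /\ dth^{123} is the positive orientation. *)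

Definition xpart (R : realType) (p : 'rV[R]_(4 + 3)) : 'rV[R]_4 := lsubmx p.

(* Pull-back by the projection M -> T^4, on constant forms. *)
Definition pullM (R : realType) (a : ext R 4) : ext R (4 + 3) :=
  \sum_(I : {set 'I_4}) a I *: base R (lshift 3 @: I)%SET.

Definition dth (R : realType) (j : 'I_3) : ext R (4 + 3) := dx R (rshift 4 j).

Definition dth123 (R : realType) : ext R (4 + 3) :=
  dth R 0 \wedge dth R 1 \wedge dth R 2.

Definition phi (R : realType) (u : 'rV[R]_4 -> R) : diff_form R (4 + 3) :=
  fun p =>
  dth123 R - (dth R 0 \wedge pullM (omega1 R) + dth R 1 \wedge pullM (omega2 R)
              + dth R 2 \wedge pullM (omega3 (u (xpart p)))).

(* The metric g and the volume form vol of a G_2-structure f are determined by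
   i_x f /\ i_y f /\ f = 6 g(x, y) vol.  In a positive frame, where
   vol = sqrt (det g) dx^{1...7}, the matrix B / 6 of the left-hand side
   divided by 6 is sqrt (det g) g, hence det (B / 6) = (sqrt (det g))^9.
   For f = phi u this gives u^{1/3} dx^{0123} /\ dth^{123}: see [G2_vol_phi]. *)
Definition G2_vol (R : realType) (f : ext R 7) : ext R 7 :=
  (\det (\matrix_(i, j)
     (top (iprod (evec R i) f \wedge iprod (evec R j) f \wedge f) / 6))
   `^ 9^-1) *: base R [set: 'I_7]%SET.

Definition vol_form (R : realType) (f : diff_form R 7) : diff_form R 7 :=
  fun p => G2_vol (f p).

Definition Vol (R : realType) (f : diff_form R 7) : R := torus_int (vol_form f).

Definition g4 (R : realType) (u : R) : 'rV[R]_4 :=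
  \row_(i < 4) if (i == 0) || (i == 3) then u `^ (2 / 3) else u `^ (- (1 / 3)).

(* A_3 at a point where u(x) = u and (ext_deriv alpha)(x) = da; the quotient by
   vol_0 = dx^{0123} is [top]. *)
Definition A3 (R : realType) (u : R) (da : ext R 4) (x y : 'rV[R]_4) : R :=
  let w1 := omega1 R in let w2 := omega2 R in
  (u `^ (1 / 3))^-1 * top
    (iprod x da \wedge iprod y w1 \wedge w2
     + iprod y da \wedge iprod x w1 \wedge w2
     + da \wedge (2^-1 *: (iprod x w1 \wedge iprod y w2
                           - iprod x w2 \wedge iprod y w1))).

(* i_{alpha^sharp} A_3 = A_3(alpha^sharp, .), as a 1-form. *)
Definition iA3 (R : realType) (u : 'rV[R]_4 -> R) (a : diff_form R 4)
  : diff_form R 4 :=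
  fun x => \sum_(j < 4)
    A3 (u x) (ext_deriv a x) (sharp (g4 (u x)) (a x)) (evec R j) *: dx R j.

Definition geodesic_rhs (R : realType) (u : 'rV[R]_4 -> R) (a : diff_form R 4)
  : diff_form R 4 :=
  let g := fun x => g4 (u x) in
  let i1 := fun x => iprod (sharp (g x) (a x)) (omega1 R) in
  let i2 := fun x => iprod (sharp (g x) (a x)) (omega2 R) in
  fun x =>
    2 *: iA3 u a x
    + u x `^ (2 / 3) *: codiff g
        (hodge_form g (fun y => u y `^ (- (2 / 3)) *: (i1 y \wedge i2 y))) x
    - (2 * u x `^ (2 / 3)) *: codiff g
        (fun z => a z \wedge
           hodge_form g
             (fun y => u y `^ (- (2 / 3)) *: (i1 y \wedge omega2 R)) z) x.

(* The computation of vol_phi.  Linear combinations of the dx^I are computed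
   on lists of ((s, k), m), which stand for (-1)^s u^k dx^I where m is the
   indicator of I. *)

Definition mset n (m : bitseq) : {set 'I_n} := [set i : 'I_n | nth false m i]%SET.

Definition monom := (nat * nat * bitseq)%type.

Definition eval_ext (R : realType) n (u : R) (l : seq monom) : ext R n :=
  \sum_(p <- l) ((-1) ^+ p.1.1 * u ^+ p.1.2) *: base R (mset n p.2).

Definition inversions n (m1 m2 : bitseq) : nat :=
  sumn [seq (nth false m1 i && (nth false m2 j && (j < i)%N) : nat)
          | i <- iota 0 n, j <- iota 0 n].

Definition mask_or n m1 m2 : bitseq :=
  mkseq (fun i => nth false m1 i || nth false m2 i) n.

Definition wedge_list n (l1 l2 : seq monom) : seq monom :=
  [seq ((p.1.1 + q.1.1 + inversions n p.2 q.2, p.1.2 + q.1.2)%N,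
        mask_or n p.2 q.2)
     | p <- l1, q <- [seq q <- l2 |
         all (fun i => ~~ (nth false p.2 i && nth false q.2 i)) (iota 0 n)]].

Definition iprod_list n (k : nat) (l : seq monom) : seq monom :=
  [seq (let m := mkseq (fun j => (j != k) && nth false p.2 j) n in
        ((p.1.1 + inversions n (mkseq (pred1 k) n) m, p.1.2)%N, m))
     | p <- l & nth false p.2 k].

Section Eval.
Variable R : realType.
Implicit Types u : R.

Lemma wedge_addl n (a b c : ext R n) : (a + b) \wedge c = a \wedge c + b \wedge c.
Proof.
by apply/ffunP => K; rewrite !ffunE -big_split; apply: eq_bigr => I _;
  rewrite !ffunE mulrDr mulrDl.
Qed.

Lemma wedge_addr n (a b c : ext R n) : c \wedge (a + b) = c \wedge a + c \wedge b.
Proof.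
by apply/ffunP => K; rewrite !ffunE -big_split; apply: eq_bigr => I _;
  rewrite !ffunE mulrDr.
Qed.

Lemma wedge_scalel n k (a c : ext R n) : (k *: a) \wedge c = k *: (a \wedge c).
Proof.
apply/ffunP => K; rewrite !ffunE scaler_sumr; apply: eq_bigr => I _.
by rewrite !ffunE -[_ *: a I]/(k * a I) mulrCA -!mulrA.
Qed.

Lemma wedge_scaler n k (a c : ext R n) : c \wedge (k *: a) = k *: (c \wedge a).
Proof.
apply/ffunP => K; rewrite !ffunE scaler_sumr; apply: eq_bigr => I _.
by rewrite !ffunE -[_ *: a _]/(k * a _) mulrCA.
Qed.

Lemma wedge0l n (c : ext R n) : 0 \wedge c = 0.
Proof. by rewrite -(scale0r (0 : ext R n)) wedge_scalel !scale0r. Qed.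

Lemma wedge0r n (c : ext R n) : c \wedge 0 = 0.
Proof. by rewrite -(scale0r (0 : ext R n)) wedge_scaler !scale0r. Qed.

Lemma wedge_base n (I J : {set 'I_n}) :
  base R I \wedge base R J =
  if [disjoint I & J] then sgn R I J *: base R (I :|: J)%SET else 0.
Proof.
apply/ffunP => K; rewrite !ffunE.
have [IK|nIK] := boolP (I \subset K); last first.
  rewrite big1 => [|L LK]; last first.
    rewrite !ffunE; case: eqP => [LI|_]; last by rewrite mulr0 mul0r.
    by rewrite LI (negbTE nIK) in LK.
  case: ifP => dIJ; rewrite !ffunE //.
  case: eqP => [KE|_]; last by rewrite scaler0.
  by rewrite KE finset.subsetUl in nIK.
rewrite (bigD1 I) //= big1 ?addr0 => [|L /andP[_ /negbTE LI]]; last first.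
  by rewrite !ffunE LI mulr0 mul0r.
rewrite !ffunE eqxx mulr1.
have -> : (K :\: I == J)%SET = [disjoint I & J] && (K == I :|: J)%SET.
  apply/eqP/andP => [<-|[dIJ /eqP ->]].
    split; first by rewrite -finset.setI_eq0 finset.setDE finset.setICA
      finset.setICr finset.setI0.
    by apply/eqP/esym; rewrite finset.setUC -{2}(finset.setID K I)
      finset.setUC (finset.setIidPr IK).
  rewrite finset.setDUl finset.setDv finset.set0U.
  by apply/finset.setDidPl; rewrite disjoint_sym.
case: ifP => dIJ /=; last by rewrite mulr0 !ffunE.
rewrite !ffunE; case: eqP => [->|_]; last by rewrite mulr0 scaler0.
rewrite finset.setDUl finset.setDv finset.set0U.
have -> : (J :\: I = J)%SET by apply/finset.setDidPl; rewrite disjoint_sym.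
by rewrite /GRing.scale /= mulr1.
Qed.

Lemma mset_or n m1 m2 : mset n (mask_or n m1 m2) = (mset n m1 :|: mset n m2)%SET.
Proof. by apply/finset.setP => i; rewrite !inE nth_mkseq. Qed.

Lemma sgn_mset n m1 m2 : sgn R (mset n m1) (mset n m2) = (-1) ^+ inversions n m1 m2.
Proof.
rewrite /sgn /inversions; congr (_ ^+ _).
rewrite cardsE -sum1_card big_mkcond /= -(pair_bigA _ (fun i j : 'I_n => if [&& i \in mset n m1, j \in mset n m2 & (j < i)%N] then 1 else 0)%N) /=.
rewrite sumnE big_allpairs_dep (_ : iota 0 n = index_iota 0 n) ?big_mkord; last by rewrite /index_iota subn0.
apply: eq_bigr => i _; rewrite big_mkord; apply: eq_bigr => j _.
by rewrite !inE; case: ifP.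
Qed.

Lemma disjoint_mset n m1 m2 : disjoint (mem (mset n m1)) (mem (mset n m2)) =
  all (fun i => ~~ (nth false m1 i && nth false m2 i)) (iota 0 n).
Proof.
rewrite -finset.setI_eq0; apply/eqP/allP => [H i|H].
  rewrite mem_iota add0n /= => lin; apply/negP => mm.
  have : Ordinal lin \in finset.setI (mset n m1) (mset n m2) by rewrite !inE.
  by rewrite H inE.
apply/finset.setP => i; rewrite !inE; apply/negbTE/H.
by rewrite mem_iota /= add0n.
Qed.

Lemma eval_ext_cons n u p l : eval_ext n u (p :: l) =
  ((-1) ^+ p.1.1 * u ^+ p.1.2) *: base R (mset n p.2) + eval_ext n u l.
Proof. by rewrite /eval_ext big_cons. Qed.

Lemma eval_ext_cat n u l1 l2 : eval_ext n u (l1 ++ l2) = eval_ext n u l1 + eval_ext n u l2.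
Proof. by rewrite /eval_ext big_cat. Qed.

Lemma eval_wedge n u l1 l2 : eval_ext n u l1 \wedge eval_ext n u l2 =
  eval_ext n u (wedge_list n l1 l2).
Proof.
elim: l1 => [|p l1 IH]; first by rewrite /eval_ext /wedge_list /= !big_nil wedge0l.
rewrite eval_ext_cons wedge_addl IH /wedge_list /= eval_ext_cat; congr (_ + _).
elim: l2 {IH} => [|q l2 IH]; first by rewrite /= /eval_ext !big_nil wedge0r.
rewrite eval_ext_cons wedge_addr IH /= wedge_scalel wedge_scaler wedge_base.
rewrite disjoint_mset; case: ifP => _; last by rewrite !scaler0 add0r.
rewrite /= eval_ext_cons /= mset_or sgn_mset !scalerA; congr (_ *: _ + _).
by rewrite !exprD; ring.
Qed.

Lemma iprod_add n v (a b : ext R n) : iprod v (a + b) = iprod v a + iprod v b.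
Proof.
by apply/ffunP => K; rewrite !ffunE -big_split; apply: eq_bigr => I _;
  rewrite !ffunE mulrDr.
Qed.

Lemma iprod_scale n v k (a : ext R n) : iprod v (k *: a) = k *: iprod v a.
Proof.
apply/ffunP => K; rewrite !ffunE scaler_sumr; apply: eq_bigr => I _.
by rewrite !ffunE -[_ *: a _]/(k * a _) mulrCA.
Qed.

Lemma iprod0 n (v : 'rV[R]_n) : iprod v 0 = 0.
Proof. by rewrite -(scale0r (0 : ext R n)) iprod_scale !scale0r. Qed.

Lemma iprod_base n (i : 'I_n) (I : {set 'I_n}) : iprod (evec R i) (base R I) =
  if i \in I then sgn R [set i]%SET (I :\ i)%SET *: base R (I :\ i)%SET else 0.
Proof.
apply/ffunP => K; rewrite !ffunE.
have iE k : (evec R i) 0 k = (k == i)%:R by rewrite mxE eqxx.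
rewrite (eq_bigr (fun k => if k == i then sgn R [set i]%SET K * base R I (i |: K)%SET else 0)); last first.
  by move=> k _; rewrite iE; case: eqP => [->|_]; rewrite ?mul1r ?mul0r.
have [iK|iK] := boolP (i \in K).
  rewrite big1 => [|k kK]; last first.
    by case: eqP => // ki; rewrite ki iK in kK.
  case: ifP => _; rewrite !ffunE //; case: eqP => [KE|_]; last by rewrite scaler0.
  by rewrite KE !inE eqxx in iK.
rewrite (bigD1 i) //= eqxx big1 ?addr0 => [|k /andP[_ /negbTE ->]] //.
rewrite ffunE.
have -> : (i |: K == I)%SET = (i \in I) && (K == I :\ i)%SET.
  apply/eqP/andP => [<-|[iI /eqP ->]]; last by rewrite finset.setD1K.
  by rewrite finset.setU1K // !inE eqxx.
case: ifP => _ /=; last by rewrite mulr0 ffunE.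
by rewrite !ffunE; case: eqP => [->|_]; rewrite ?mulr0 ?scaler0.
Qed.

Lemma eval_iprod n u (i : 'I_n) l : iprod (evec R i) (eval_ext n u l) =
  eval_ext n u (iprod_list n i l).
Proof.
elim: l => [|p l IH]; first by rewrite /eval_ext /iprod_list /= !big_nil iprod0.
rewrite eval_ext_cons iprod_add IH iprod_scale iprod_base /iprod_list /= inE.
case: ifP => _; last by rewrite scaler0 add0r.
rewrite /= eval_ext_cons /=.
set m := mkseq (fun j : nat => (j != i :> nat) && _) n.
have -> : (mset n p.2 :\ i)%SET = mset n m.
  by apply/finset.setP => j; rewrite !inE nth_mkseq //= -val_eqE.
have -> : [set i]%SET = mset n (mkseq (pred1 (i : nat)) n).
  by apply/finset.setP => j; rewrite !inE nth_mkseq //= -val_eqE.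
rewrite sgn_mset scalerA; congr (_ *: _ + _).
by rewrite !exprD; ring.
Qed.

Definition phi_list : seq monom :=
  let x i := [:: (0%N, 0%N, mkseq (pred1 i) 7)] in
  let w := wedge_list 7 in
  let neg := map (fun p : monom => (p.1.1.+1, p.1.2, p.2)) in
  w (w (x 4) (x 5)) (x 6) ++
  neg (w (x 4) (w (x 0) (x 1) ++ w (x 2) (x 3)) ++
   w (x 5) (w (x 0) (x 2) ++ w (x 3) (x 1)) ++
   w (x 6) ([seq (p.1.1, p.1.2.+1, p.2) | p <- w (x 0) (x 3)] ++ w (x 1) (x 2))).

Lemma eval_neg n u l :
  eval_ext n u [seq (p.1.1.+1, p.1.2, p.2) | p <- l] = - eval_ext n u l.
Proof.
elim: l => [|p l IH]; first by rewrite /eval_ext /= !big_nil oppr0.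
by rewrite /= !eval_ext_cons IH /= opprD exprS mulN1r mulNr scaleNr.
Qed.

Lemma eval_scale n u l :
  eval_ext n u [seq (p.1.1, p.1.2.+1, p.2) | p <- l] = u *: eval_ext n u l.
Proof.
elim: l => [|p l IH]; first by rewrite /eval_ext /= !big_nil scaler0.
by rewrite /= !eval_ext_cons IH /= scalerDr scalerA exprS mulrCA.
Qed.

Lemma pullM_eval u l : (forall p, p \in l -> size p.2 <= 4)%N ->
  pullM (eval_ext 4 u l) = eval_ext 7 u l.
Proof.
have pullD (a b : ext R 4) : pullM (a + b) = pullM a + pullM b.
  by rewrite /pullM -big_split; apply: eq_bigr => I _; rewrite ffunE scalerDl.
have pullZ k (a : ext R 4) : pullM (k *: a) = k *: pullM a.
  by rewrite /pullM scaler_sumr; apply: eq_bigr => I _; rewrite ffunE scalerA.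
elim: l => [|p l IH] H.
  by rewrite /eval_ext !big_nil -(scale0r (0 : ext R 4)) pullZ !scale0r.
rewrite !eval_ext_cons pullD pullZ IH => [|q ql]; last by rewrite H // inE ql orbT.
congr (_ *: _ + _).
rewrite /pullM (bigD1 (mset 4 p.2)) //= big1 ?addr0 => [|I /negbTE IE]; last first.
  by rewrite ffunE IE scale0r.
rewrite ffunE eqxx scale1r; congr base.
apply/finset.setP => i; rewrite inE; apply/imsetP/idP => [[j]|pi].
  by rewrite inE => pj ->.
have ilt : (i < 4)%N.
  rewrite ltnNge; apply/negP => i4; move: pi; rewrite nth_default //.
  by apply: leq_trans i4; apply: H; rewrite inE eqxx.
by exists (Ordinal ilt); [rewrite inE | apply: val_inj].
Qed.

Lemma dx_eval n u (i : 'I_n) :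
  dx R i = eval_ext n u [:: (0%N, 0%N, mkseq (pred1 (i : nat)) n)].
Proof.
rewrite /eval_ext big_seq1 /= mulr1 scale1r; congr base.
by apply/finset.setP => j; rewrite !inE nth_mkseq //= -val_eqE.
Qed.

Lemma phi_eval (v : 'rV[R]_4 -> R) p :
  phi v p = eval_ext 7 (v (xpart p)) phi_list.
Proof.
rewrite /phi /omega1 /omega2 /omega3; set u := v _.
rewrite !(@dx_eval 4 u) !eval_wedge -eval_scale -!eval_ext_cat.
rewrite !pullM_eval; try by apply/(@allP _ (fun q : monom => (size q.2 <= 4)%N)); vm_compute.
rewrite /dth123 /dth !(@dx_eval 7 u) !eval_wedge -!eval_ext_cat -eval_neg -eval_ext_cat.
by congr eval_ext; vm_compute.
Qed.

Definition B_list (i j : nat) : seq (nat * nat) :=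
  [seq p.1 | p <- wedge_list 7
     (wedge_list 7 (iprod_list 7 i phi_list) (iprod_list 7 j phi_list)) phi_list
   & all (nth false p.2) (iota 0 7)].

Lemma B_listE (i j : 'I_7) :
  [seq (odd p.1, p.2) | p <- B_list i j] =
  if i == j then nseq 6 (false, (i %% 3 == 0)%N : nat) else [::].
Proof.
pose P (i j : nat) := [seq (odd p.1, p.2) | p <- B_list i j] ==
  if i == j then nseq 6 (false, (i %% 3 == 0)%N : nat) else [::].
have /allP H : all (fun i => all (P i) (iota 0 7)) (iota 0 7) by vm_compute.
have /allP Hi : all (P i) (iota 0 7) by apply: H; rewrite mem_iota /=.
by apply/eqP; apply: (Hi j); rewrite mem_iota /=.
Qed.

Lemma top_eval u l : top (eval_ext 7 u l) =
  \sum_(p <- l | all (nth false p.2) (iota 0 7)) (-1) ^+ p.1.1 * u ^+ p.1.2.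
Proof.
elim: l => [|p l IH]; first by rewrite /eval_ext !big_nil /top ffunE.
rewrite eval_ext_cons big_cons /top ffunE -/(top (eval_ext 7 u l)) IH !ffunE.
have -> : ([set: 'I_7] == mset 7 p.2)%SET = all (nth false p.2) (iota 0 7).
  apply/eqP/allP => [H i|H].
    rewrite mem_iota /= => ilt.
    have : Ordinal ilt \in [set: 'I_7]%SET by rewrite inE.
    by rewrite H inE.
  by apply/finset.setP => i; rewrite !inE; apply/esym/H; rewrite mem_iota /=.
by case: ifP => _; rewrite /GRing.scale /= ?mulr1 // mulr0 add0r.
Qed.

Lemma G2_vol_phi (v : 'rV[R]_4 -> R) (p : 'rV[R]_(4 + 3)) : 0 < v (xpart p) ->
  vol_form (phi v) p = v (xpart p) `^ (1 / 3) *: base R [set: 'I_7]%SET.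
Proof.
move=> u0; rewrite /vol_form /G2_vol phi_eval; set u := v _ in u0 *.
congr (_ *: _).
rewrite (_ : \matrix_(i, j) _ =
  diag_mx (\row_(i < 7) u ^+ (i %% 3 == 0)%N)); last first.
  apply/matrixP => i j; rewrite !mxE !eval_iprod !eval_wedge top_eval.
  rewrite -big_filter.
  rewrite (_ : \sum_(q <- _) _ = \sum_(q <- [seq (odd q.1, q.2) | q <- B_list i j])
     (-1) ^+ q.1 * u ^+ q.2); last first.
    by rewrite !big_map; apply: eq_bigr => q _; rewrite signr_odd.
  rewrite B_listE; case: eqP => [->|_]; last by rewrite big_nil mul0r.
  rewrite mulr1n big_nseq /= !mul1r addr0; by field.
set D := diag_mx _.
have -> : \det D = u `^ 3.
  rewrite /D det_diag !big_ord_recl big_ord0 !mxE /= !expr0 !expr1 !mul1r !mulr1.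
  by rewrite powR_mulrn ?ltW // !exprS expr0 mulr1.
by rewrite -powRrM; congr (_ `^ _); field.
Qed.

End Eval.

(* Main.v *)
Require Import Defs.
From mathcomp Require Import all_boot all_order all_algebra.
From mathcomp Require Import all_classical all_reals all_analysis.
From mathcomp Require Import ring lra.
Import Order.TTheory GRing.Theory Num.Theory.
Import numFieldNormedType.Exports.
Local Open Scope ring_scope.
Local Open Scope classical_set_scope.

(* With alpha = h dx^3 and f = d_0 h = d_t u, the dx^3-component of
   the geodesic equation only involves d_0-derivatives and reads
   h_t = 2 f h / u - u_0 h^2 / u^2.  Differentiating Vol = int u^{1/3} twice
   gives 9 Vol_tt = int (3 u^{-2/3} f_t - 2 u^{-5/3} f^2).  The first term is
   integrated by parts in x^0 with f = d_0 h, and substituting h_t completes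
   the square. *)

(** * Integration over the cube *)

(** The volume is a sevenfold iterated integral, so there is no single measure on the cube to which
    a theorem on differentiation under the integral sign could be applied. Each analytic fact is
    proved for one integral over [0, 1] and carried to the cube by induction on the dimension. For
    the induction to close, the inner integrals must again be continuous in the outer variable
    together with the time, hence joint continuity is the regularity used throughout. Integration by
    parts is needed only in x^0. This is the outermost variable both on T^4 and on M, so the
    one-dimensional fundamental theorem of calculus suffices and the order of integration never
    changes. The torus T^3 is not integrated out: the integrands are pulled back along [xpart] and
    all seven variables are kept. *)

Section CubeIntegral.
Context {R : realType}.
Notation mu := (@lebesgue_measure R).

Lemma cvg_rV (T : topologicalType) n (F : set_system T) (FF : Filter F)
    (f : T -> 'rV[R]_n) (l : 'rV[R]_n) :
  (forall i, f x 0 i @[x --> F] --> l 0 i) -> f @ F --> l.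
Proof.
move=> H; apply/cvg_ballP => e e0.
suff : \forall x \near F, forall i, ball (l 0 i) e (f x 0 i).
  by apply: filterS => x Hx; split=> // j i; rewrite !ord1.
by apply: filter_forall => i; move/cvg_ballP: (H i); apply.
Qed.

Lemma cvg_pair_nbhs {T : Type} {U V : topologicalType} {F : set_system T}
    {FF : Filter F} {f : T -> U} {g : T -> V} {a : U} {b : V} :
  f @ F --> a -> g @ F --> b -> (f x, g x) @[x --> F] --> (a, b).
Proof. by move=> fa gb; apply: (@cvg_pair _ _ _ F (nbhs a) (nbhs b)). Qed.

Lemma cvg_row_mx (T : topologicalType) m (F : set_system T) (FF : Filter F)
    (f : T -> R) (g : T -> 'rV[R]_m) (a : R) (l : 'rV[R]_m) :
  f @ F --> a -> g @ F --> l ->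
  (row_mx ((f x)%:M : 'rV[R]_1) (g x) : 'rV[R]_m.+1) @[x --> F] -->
  (row_mx (a%:M : 'rV[R]_1) l : 'rV[R]_m.+1).
Proof.
move=> fa gl; apply: cvg_rV => i; rewrite mxE.
case: splitP => j ij.
  rewrite mxE !ord1 mulr1n; under eq_fun do rewrite mxE.
  move: ij; rewrite ord1 => ij; case: splitP => k kj; last by move: kj; rewrite ij.
  by under eq_fun do rewrite mxE ord1 mulr1n.
under eq_fun do rewrite mxE.
case: splitP => k kj; first by case: k kj => -[]//= lt0; rewrite ij.
have -> : k = j by apply: val_inj; move: kj; rewrite ij /= => -[].
by apply: (@cvg_comp _ _ _ g (fun M : 'rV[R]_m => M 0 j) _ (nbhs l)) => //;
  exact: coord_continuous.
Qed.

Lemma continuous_integrable01 (f : R -> R) : continuous f ->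
  mu.-integrable `[0, 1]%classic (EFin \o f).
Proof.
move=> cf; apply: continuous_compact_integrable; first exact: segment_compact.
exact: continuous_subspaceT.
Qed.

Lemma Rintegral01_cst (r : R) : \int[mu]_(s in `[0, 1]) r = r.
Proof. rewrite Rintegral_cst// [X in fine X](lebesgue_measure_itv `[0, 1]%R) /= lte01 /= subr0 mulr1 //. Qed.

(** Joint continuity at every point of the fibre over [p]. Fixing [p] allows a path to be regular
    over the times in [J] only, while the space variable stays unrestricted. *)
Definition continuous2 {P Q : topologicalType} (F : P -> Q -> R) (p : P) :=
  forall q, {for (p, q), continuous (fun z => F z.1 z.2)}.

Lemma continuous2_r {P Q : topologicalType} {F : P -> Q -> R} {p} :
  continuous2 F p -> continuous (F p).
Proof.
move=> cF q; apply: (@cvg_comp _ _ _ (fun q => (p, q)) _ _ (nbhs (p, q)) _ _ (cF q)).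
by apply: cvg_pair_nbhs; [exact: cvg_cst|exact: cvg_id].
Qed.

Lemma continuous2_l {P Q : topologicalType} {F : P -> Q -> R} {p} q :
  continuous2 F p -> {for p, continuous (F ^~ q)}.
Proof.
move=> cF; apply: (@cvg_comp _ _ _ (fun p => (p, q)) _ _ (nbhs (p, q)) _ _ (cF q)).
by apply: cvg_pair_nbhs; [exact: cvg_id|exact: cvg_cst].
Qed.

(** A tube lemma: joint continuity gives, around each s, a product neighbourhood on which the bound
    holds, and compactness of [0, 1] yields one neighbourhood of [p0] valid for all s. *)
Lemma continuous2_unif (P : topologicalType) (G : P -> R -> R) p0 (e : R) :
  0 < e -> continuous2 G p0 ->
  \forall p \near p0, forall s, `[0, 1]%classic s -> `|G p0 s - G p s| <= e.
Proof.
move=> e0 cG.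
have /compact_near_coveringP K := @segment_compact R 0 1.
have := K P (nbhs p0) (fun p s => `|G p0 s - G p s| <= e) _ _.
apply=> s _ /=.
have e20 : 0 < e / 2 by rewrite divr_gt0.
have /cvgrPdist_lt/(_ _ e20)[[A B] [/= nA nB] AB] := cG s.
exists (B, A) => //= -[s' p] /= [Bs' Ap].
have -> : G p0 s' - G p s' = (G p0 s - G p s') - (G p0 s - G p0 s') by ring.
rewrite (le_trans (ler_normB _ _))// (splitr e) lerD// ltW//.
  exact: (AB (p, s')).
by apply: (AB (p0, s')); split => //; exact: nbhs_singleton nA.
Qed.

(** The interval has length 1, so a uniform bound on the integrands bounds the difference of the
    integrals. Continuity is asked near [p0], and not only at [p0], because [G p] has to be
    integrable for the nearby [p] as well. *)
Lemma cvg_Rintegral01 (P : topologicalType) (G : P -> R -> R) p0 :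
  (\forall p \near p0, continuous2 G p) ->
  {for p0, continuous (fun p => \int[mu]_(s in `[0, 1]) G p s)}.
Proof.
move=> cG; have cG0 := nbhs_singleton cG.
apply/cvgrPdist_le => e e0; near=> p.
have cGp : continuous2 G p by near: p.
have i0 := continuous_integrable01 _ (continuous2_r cG0).
have ip := continuous_integrable01 _ (continuous2_r cGp).
have cB : continuous (fun s => G p0 s - G p s).
  by move=> s; apply: cvgB; [exact: (continuous2_r cG0)|exact: (continuous2_r cGp)].
have iB := continuous_integrable01 _ cB.
have cN : continuous (fun s => `|G p0 s - G p s|).
  by move=> s; apply: cvg_norm; exact: cB.
rewrite -RintegralB//; apply: le_trans (le_normr_Rintegral _ _) _ => //.
rewrite -[leRHS]Rintegral01_cst; apply: le_Rintegral => //.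
- exact: continuous_integrable01.
- by apply: continuous_integrable01 => ?; exact: cvg_cst.
- by near: p; exact: continuous2_unif.
Unshelve. all: by end_near. Qed.

Lemma continuous2_slice {P : topologicalType} {n} {F : P -> 'rV[R]_n.+1 -> R} {p} :
  continuous2 F p ->
  forall s, continuous2 (fun ps y => F ps.1 (row_mx (ps.2%:M : 'rV_1) y)) (p, s).
Proof.
move=> cF s y.
apply: (@cvg_comp _ _ _
  (fun z : P * R * 'rV_n => (z.1.1, row_mx (z.1.2%:M : 'rV_1) z.2 : 'rV_n.+1))
  _ _ (nbhs (p, row_mx (s%:M : 'rV_1) y : 'rV_n.+1)) _ _ (cF _)).
apply: cvg_pair_nbhs.
  by apply: (@cvg_comp _ _ _ fst fst _ (nbhs (p, s))); exact: cvg_fst.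
apply: cvg_row_mx; last exact: cvg_snd.
by apply: (@cvg_comp _ _ _ fst snd _ (nbhs (p, s))); [exact: cvg_fst|exact: cvg_snd].
Qed.

(** In the induction the outer integration variable joins the parameter: the hypothesis is used with
    [P * R] in place of [P]. This is why [P] is an arbitrary topological space and is
    generalised. *)
Lemma cvg_cube_int n (P : topologicalType) (F : P -> 'rV[R]_n -> R) p0 :
  (\forall p \near p0, continuous2 F p) ->
  {for p0, continuous (fun p => cube_int (F p))}.
Proof.
elim: n P F p0 => [|n IH] P F p0 cF /=.
  exact: continuous2_l (nbhs_singleton cF).
apply: cvg_Rintegral01; move/near_join: cF.
apply: filterS => p cF s.
apply: (IH (P * R)%type (fun ps y => F ps.1 (row_mx (ps.2%:M : 'rV_1) y))).
have : \forall ps \near (p, s), continuous2 F ps.1.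
  exact: (@cvg_fst _ _ (nbhs p) (nbhs s) _ _ cF).
by apply: filterS => -[p' s'] /= /continuous2_slice.
Qed.

(** Dominated differentiation under the integral. The dominating function is a constant: [G' t] is
    bounded on the compact interval, and [G' x] is uniformly close to it for x near t. *)
Lemma is_derive_Rintegral01 (J : set R) (G G' : R -> R -> R) :
  open J ->
  (forall t, J t -> continuous2 G t) -> (forall t, J t -> continuous2 G' t) ->
  (forall t s, J t -> is_derive t (1 : R) (G ^~ s) (G' t s)) ->
  forall t, J t -> is_derive t (1 : R)
    (fun t => \int[mu]_(s in `[0, 1]) G t s) (\int[mu]_(s in `[0, 1]) G' t s).
Proof.
move=> oJ cG cG' dG t Jt.
have /compact_bounded[M [_ HM]] : compact (G' t @` `[0, 1]%classic).
  apply: continuous_compact (@segment_compact R 0 1).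
  by apply: continuous_subspaceT; exact: continuous2_r (cG' t Jt).
have : \forall t' \near t, J t' /\
    forall s, `[0, 1]%classic s -> `|G' t s - G' t' s| <= 1.
  apply: filterI; first exact: open_nbhs_nbhs.
  exact: (continuous2_unif R G' t 1 ltr01 (cG' t Jt)).
move=> /nbhs_ballP[e /= e0 H].
have I_ball x : `]t - e, t + e[%classic x -> ball t e x.
  by rewrite /= in_itv /= -ltr_distlC.
have It : `]t - e, t + e[%classic t by rewrite /= in_itv /= ltrBlDr ltrDl e0.
have intG x : `]t - e, t + e[%classic x -> mu.-integrable `[0, 1]%classic (EFin \o G x).
  move=> /I_ball/H[Jx _]; apply: continuous_integrable01.
  exact: continuous2_r (cG x Jx).
have dG1 x y : `]t - e, t + e[%classic x -> `[0, 1]%classic y -> derivable (G ^~ y) x 1.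
  by move=> /I_ball/H[Jx _] _; have [] := dG x y Jx.
have dGE x y : J x -> partial1of2 G x y = G' x y.
  by move=> Jx; rewrite partial1of2E; have [_ ->] := dG x y Jx.
(* Only numbers strictly above [M] are known to bound [G' t], whence [|M| + 1]; the second unit is
   the uniform distance from [G' t] to [G' x]. *)
have ub x y : `]t - e, t + e[%classic x -> `[0, 1]%classic y ->
    `|partial1of2 G x y| <= `|M| + 2.
  move=> /I_ball/H[Jx Hx] y01; rewrite dGE//.
  have -> : G' x y = G' t y - (G' t y - G' x y) by ring.
  rewrite (le_trans (ler_normB _ _))//.
  have -> : `|M| + 2 = `|M| + 1 + 1 by ring.
  rewrite lerD ?Hx//; apply: HM; last by exists y.
  by rewrite (le_lt_trans (ler_norm M))// ltrDl.
have ic : mu.-integrable `[0, 1]%classic (EFin \o (fun=> `|M| + 2)).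
  by apply: continuous_integrable01 => ?; exact: cvg_cst.
have c0 (y : R) : 0 <= `|M| + 2 :> R by rewrite addr_ge0.
split.
  exact: (@derivable_under_integral _ _ _ mu G _ _ t _ _ It intG dG1 _ c0 ic ub).
rewrite -derive1E (@differentiation_under_integral _ _ _ mu G _ _ t _ _ It intG dG1 _ c0 ic ub)//.
by apply: eq_Rintegral => y _; exact: dGE.
Unshelve. all: by end_near. Qed.

Lemma continuous2_cube_int {P : topologicalType} {n} {F : P -> 'rV[R]_n.+1 -> R} {p} :
  (\forall p' \near p, continuous2 F p') ->
  continuous2 (fun p s => cube_int (fun y => F p (row_mx (s%:M : 'rV_1) y))) p.
Proof.
move=> cF s.
apply: (cvg_cube_int n (P * R)%type (fun ps y => F ps.1 (row_mx (ps.2%:M : 'rV_1) y))).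
have : \forall ps \near (p, s), continuous2 F ps.1.
  exact: (@cvg_fst _ _ (nbhs p) (nbhs s) _ _ cF).
by apply: filterS => -[p' s'] /= /continuous2_slice.
Qed.

Lemma is_derive_cube_int n (J : set R) (F F' : R -> 'rV[R]_n -> R) :
  open J ->
  (forall t, J t -> continuous2 F t) -> (forall t, J t -> continuous2 F' t) ->
  (forall t x, J t -> is_derive t (1 : R) (F ^~ x) (F' t x)) ->
  forall t, J t -> is_derive t (1 : R)
    (fun t => cube_int (F t)) (cube_int (F' t)).
Proof.
move=> oJ; elim: n F F' => [|n IH] F F' cF cF' dF t Jt /=; first exact: dF.
have near_cont (H : R -> 'rV[R]_n.+1 -> R) : (forall t, J t -> continuous2 H t) ->
    forall t, J t -> \forall t' \near t, continuous2 H t'.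
  by move=> cH t' Jt'; near=> t''; apply: cH; near: t''; exact: open_nbhs_nbhs.
apply: (is_derive_Rintegral01 J
  (fun t s => cube_int (fun y => F t (row_mx (s%:M : 'rV_1) y)))
  (fun t s => cube_int (fun y => F' t (row_mx (s%:M : 'rV_1) y)))) => //.
- by move=> t' Jt'; apply: continuous2_cube_int; exact: near_cont.
- by move=> t' Jt'; apply: continuous2_cube_int; exact: near_cont.
(* The induction hypothesis concerns the time alone, so here the outer variable s is frozen instead
   of being added to the parameter. *)
have slice (H : R -> 'rV[R]_n.+1 -> R) t' s : continuous2 H t' ->
    continuous2 (fun t y => H t (row_mx (s%:M : 'rV_1) y)) t'.
  move=> /continuous2_slice cH y.
  apply: (@cvg_comp _ _ _ (fun z : R * 'rV_n => ((z.1, s), z.2)) _ _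
    (nbhs ((t', s), y)) _ _ (cH s y)).
  apply: cvg_pair_nbhs; last exact: cvg_snd.
  by apply: cvg_pair_nbhs; [exact: cvg_fst|exact: cvg_cst].
move=> t' s Jt'.
apply: (IH (fun t y => F t (row_mx (s%:M : 'rV_1) y))
  (fun t y => F' t (row_mx (s%:M : 'rV_1) y))) => //.
- by move=> t'' Jt''; apply: slice; exact: cF.
- by move=> t'' Jt''; apply: slice; exact: cF'.
Unshelve. all: by end_near. Qed.

Lemma continuous_slice {n} {f : 'rV[R]_n.+1 -> R} :
  continuous f ->
  forall s : R, continuous2 (fun (s : R) (y : 'rV[R]_n) => f (row_mx (s%:M : 'rV_1) y)) s.
Proof.
move=> cf s y; apply: (@cvg_comp _ _ _
  (fun z : R * 'rV_n => row_mx (z.1%:M : 'rV_1) z.2 : 'rV_n.+1)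
  _ _ (nbhs (row_mx (s%:M : 'rV_1) y : 'rV_n.+1)) _ _ (cf _)).
by apply: cvg_row_mx; [exact: cvg_fst|exact: cvg_snd].
Qed.

Lemma continuous_cube_int_slice {n} {f : 'rV[R]_n.+1 -> R} :
  continuous f -> continuous (fun s => cube_int (fun y => f (row_mx (s%:M : 'rV_1) y))).
Proof.
move=> cf s; have cs := continuous_slice cf.
by apply: (cvg_cube_int n R _ s); exact: filterE cs.
Qed.

Lemma cube_intD n (f g : 'rV[R]_n -> R) : continuous f -> continuous g ->
  cube_int (fun x => f x + g x) = cube_int f + cube_int g.
Proof.
elim: n f g => [//|n IH] f g cf cg /=.
rewrite -RintegralD//; last 2 first.
- exact/continuous_integrable01/continuous_cube_int_slice.
- exact/continuous_integrable01/continuous_cube_int_slice.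
apply: eq_Rintegral => s _; apply: IH.
  exact: continuous2_r (continuous_slice cf s).
exact: continuous2_r (continuous_slice cg s).
Qed.

Lemma cube_intZ n (k : R) (f : 'rV[R]_n -> R) : continuous f ->
  cube_int (fun x => k * f x) = k * cube_int f.
Proof.
elim: n f => [//|n IH] f cf /=.
rewrite -RintegralZl//; last exact/continuous_integrable01/continuous_cube_int_slice.
apply: eq_Rintegral => s _; apply: IH.
exact: continuous2_r (continuous_slice cf s).
Qed.

Lemma cube_int_ge0 n (f : 'rV[R]_n -> R) : (forall x, 0 <= f x) -> 0 <= cube_int f.
Proof. by elim: n f => [|n IH] f f0 /=; [exact: f0|apply: Rintegral_ge0 => s _; exact: IH]. Qed.

(** With [H s] the integral of [f] over the slice x^0 = s, differentiation under the integral makes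
    the integral of [f'] equal to that of the derivative of [H], hence to [H 1 - H 0]. Periodicity
    identifies the two end slices. *)
Lemma cube_int_pderiv0 n (f f' : 'rV[R]_n.+1 -> R) :
  continuous f -> continuous f' ->
  (forall x, is_derive x (evec R 0) f (f' x)) ->
  (forall x, f (x + evec R 0) = f x) -> cube_int f' = 0.
Proof.
move=> cf cf' df pf /=.
pose rm (s : R) y : 'rV[R]_n.+1 := row_mx (s%:M : 'rV[R]_1) y.
pose H s := cube_int (fun y => f (rm s y)).
have rmD s h y : rm (s + h) y = rm s y + h *: evec R 0.
  apply/rowP => i; rewrite /rm !mxE; case: splitP => j ij; rewrite ?mxE.
    rewrite !ord1 /= !mulr1n; congr (_ + _).
    have -> : i = 0 by apply: val_inj; rewrite /= ij ord1.
    by rewrite eqxx mulr1.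
  have -> : (i == 0) = false by apply/eqP => i0; move: ij; rewrite i0.
  by rewrite mulr0 addr0.
have dH s : is_derive s (1 : R) H (cube_int (fun y => f' (rm s y))).
  apply: (is_derive_cube_int n setT (fun s y => f (rm s y)) (fun s y => f' (rm s y))) => //.
  - exact: openT.
  - by move=> t _; exact: continuous_slice.
  - by move=> t _; exact: continuous_slice.
  (* The difference quotient in the slice variable is literally the one of [f] in the direction e_0,
     by [rmD]. *)
  move=> t x _; have [D1 D2] := df (rm t x).
  have E : (fun h : R => h^-1 *: (((fun s => f (rm s x)) \o shift t) (h *: (1 : R)) - f (rm t x)))
     = (fun h => h^-1 *: ((f \o shift (rm t x)) (h *: evec R 0) - f (rm t x))).
    apply/funext => h /=; congr (_ *: (f _ - _)).
    by rewrite /GRing.scale /= mulr1 addrC rmD addrC.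
  by split; [rewrite /derivable E|rewrite /derive E].
have cH : continuous H by exact: continuous_cube_int_slice.
have cH' := continuous_cube_int_slice cf'.
rewrite /Rintegral (@continuous_FTC2 _ _ H)//.
- rewrite -EFinB /=; apply/eqP; rewrite subr_eq0; apply/eqP; congr cube_int; apply/funext => y.
  by rewrite -(pf (rm 0 y)) -[X in rm X y]add0r rmD scale1r.
- exact: continuous_subspaceT.
- split.
  + by move=> x _; have [] := dH x.
  + exact/cvg_at_right_filter/cH.
  + exact/cvg_at_left_filter/cH.
- by move=> x _; rewrite derive1E; have [] := dH x.
Qed.

End CubeIntegral.

(** * Pointwise exterior algebra on T^4 *)

(* The masks of the forms dx^I, as used by [Defs.mset]; the plain name [mset] is
   shadowed by the one of probability_measure. *)
Local Notation m1000 := [:: true; false; false; false].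
Local Notation m0001 := [:: false; false; false; true].
Local Notation m1001 := [:: true; false; false; true].
Local Notation m0110 := [:: false; true; true; false].
Local Notation m0111 := [:: false; true; true; true].
Local Notation m1110 := [:: true; true; true; false].
Local Notation m1111 := [:: true; true; true; true].

Section Forms.
Context {R : realType}.
Implicit Types u c : R.

Lemma eval_ext1E n (l : seq monom) :
  eval_ext n (1 : R) l = \sum_(p <- l) (-1) ^+ odd p.1.1 *: base R (Defs.mset n p.2).
Proof. by apply: eq_bigr => p _; rewrite expr1n mulr1 signr_odd. Qed.

Lemma base_eval n (m : bitseq) : base R (Defs.mset n m) = eval_ext n 1 [:: (0%N, 0%N, m)].
Proof. by rewrite eval_ext1E big_seq1 expr0 scale1r. Qed.

(** Decides identities between constant-coefficient forms by computing on lists of monomials. The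
    parameter of [eval_ext] is set to 1 since no power of u occurs, and the sign exponents are taken
    modulo 2, so that each monomial ends up with coefficient 1 or -1. *)
Ltac forms := rewrite ?/omega1 ?/omega2 ?base_eval ?(@dx_eval R 4 1) ?eval_wedge -?eval_ext_cat
   ?eval_iprod ?eval_wedge !eval_ext1E;
  repeat (let l := fresh "l" in set l := (X in \sum_(p <- X) _); vm_compute in l; rewrite /l {l});
  rewrite ?(big_cons, big_nil) /= ?expr0 ?expr1 ?scale1r ?scaleN1r ?addr0 ?add0r.

Lemma iprod3_omega1 : iprod (evec R 3) (omega1 R) = - dx R 2.
Proof. by forms. Qed.

Lemma iprod3_omega2 : iprod (evec R 3) (omega2 R) = dx R 1.
Proof. by forms. Qed.

Lemma dx21 : dx R (2 : 'I_4) \wedge dx R 1 = - base R (Defs.mset 4 m0110).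
Proof. by forms. Qed.

Lemma dx2_omega2 : dx R 2 \wedge omega2 R = base R (Defs.mset 4 m0111).
Proof. by forms. Qed.

Lemma dx30 : dx R (3 : 'I_4) \wedge base R (Defs.mset 4 m1000) = - base R (Defs.mset 4 m1001).
Proof. by forms. Qed.

Lemma dx03 : dx R (0 : 'I_4) \wedge dx R 3 = base R (Defs.mset 4 m1001).
Proof. by forms. Qed.

Lemma iprod3_base03 : iprod (evec R 3) (base R (Defs.mset 4 m1001)) = - dx R 0.
Proof. by forms. Qed.

Lemma dx02_omega2 : dx R 0 \wedge dx R 2 \wedge omega2 R = base R (Defs.mset 4 m1111).
Proof. by forms. Qed.

Lemma base03_12 : base R (Defs.mset 4 m1001) \wedge base R (Defs.mset 4 m0110) = base R (Defs.mset 4 m1111).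
Proof. by forms. Qed.

Lemma dx_base12 (i : 'I_4) : (dx R i \wedge base R (Defs.mset 4 m0110)) (Defs.mset 4 m1110) = (i == 0)%:R.
Proof.
case: i => -[|[|[|[|//]]]] lti; forms; rewrite !ffunE ?eqxx //.
by case: eqP => [/finset.setP/(_ 0)|//]; rewrite !inE.
Qed.

(** * The Hodge star of [g4], the codifferential and the geodesic equation *)

Lemma hodge_coef n (g : 'rV[R]_n) (b : ext R n) (J : {set 'I_n}) :
  hodge g b J = Num.sqrt (\prod_i g 0 i) * (\prod_(i in ~: J) (g 0 i)^-1)
    * sgn R (~: J) J * b (~: J)%SET.
Proof.
rewrite /hodge sum_ffunE (bigD1 (~: J)%SET) //= [X in _ + X]big1 ?addr0 => [|I nIJ].
  by rewrite !ffunE finset.setCK eqxx /GRing.scale /= mulr1.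
rewrite !ffunE; case: eqP => [JI|_]; last by rewrite scaler0.
by rewrite JI finset.setCK eqxx in nIJ.
Qed.

Lemma setC_mset n m : (~: Defs.mset n m)%SET = Defs.mset n (mkseq (fun i => ~~ nth false m i) n).
Proof. by apply/finset.setP => i; rewrite !inE nth_mkseq. Qed.

Lemma hodge_scale_base n (g : 'rV[R]_n) c m :
  let m' := mkseq (fun i => ~~ nth false m i) n in
  hodge g (c *: base R (Defs.mset n m)) =
  (Num.sqrt (\prod_i g 0 i) * (\prod_(i < n | nth false m i) (g 0 i)^-1)
    * (-1) ^+ odd (inversions n m m') * c) *: base R (Defs.mset n m').
Proof.
move=> m'; apply/ffunP => J; rewrite hodge_coef !ffunE.
have -> : (~: J == Defs.mset n m)%SET = (J == Defs.mset n m')%SET.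
  by rewrite -setC_mset (can2_eq (@finset.setCK _) (@finset.setCK _)).
case: eqP => [->|_]; last by rewrite !scaler0 mulr0.
rewrite /GRing.scale /= !mulr1 -setC_mset finset.setCK setC_mset sgn_mset signr_odd.
by do 3 congr (_ * _); apply: eq_bigl => i; rewrite inE.
Qed.

(** All exponents of u in the metric and in the geodesic equation are multiples of 1/3. In terms of
    r = [cbrt u] they become integer powers, and the identities become rational ones that [field]
    can settle. *)
Definition cbrt u : R := u `^ (1 / 3).

Lemma cbrt_gt0 {u} : 0 < u -> 0 < cbrt u.
Proof. exact: powR_gt0. Qed.

Lemma powR_cbrt u k : u `^ (k / 3) = cbrt u `^ k.
Proof. by rewrite /cbrt -powRrM; congr (_ `^ _); ring. Qed.

Lemma cbrtK u : 0 < u -> cbrt u ^+ 3 = u.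
Proof. by move=> u0; rewrite -powR_mulrn ?ltW ?cbrt_gt0// -powR_cbrt divff// powRr1// ltW. Qed.

Lemma powR23 u : 0 < u -> u `^ (2 / 3) = cbrt u ^+ 2.
Proof. by move=> u0; rewrite powR_cbrt powR_mulrn// ltW// cbrt_gt0. Qed.

Lemma powRN23 u : 0 < u -> u `^ (- (2 / 3)) = (cbrt u ^+ 2)^-1.
Proof. by move=> u0; rewrite powRN powR23. Qed.

Lemma g4E u : 0 < u ->
  [/\ g4 u 0 0 = cbrt u ^+ 2, g4 u 0 1 = (cbrt u)^-1,
      g4 u 0 2 = (cbrt u)^-1 & g4 u 0 3 = cbrt u ^+ 2].
Proof. by move=> u0; rewrite !mxE /= powRN powR23. Qed.

Lemma big_ord4 (T : Type) (idx : T) (op : Monoid.law idx) (F : 'I_4 -> T) :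
  \big[op/idx]_(i < 4) F i = op (F 0) (op (F 1) (op (F 2) (F 3))).
Proof.
rewrite !big_ord_recl big_ord0 Monoid.mulm1.
by congr (op (F _) (op (F _) (op (F _) (F _)))); apply: val_inj.
Qed.

Lemma sqrt_det_g4 u : 0 < u -> Num.sqrt (\prod_i g4 u 0 i) = cbrt u.
Proof.
move=> u0; rewrite big_ord4 /=; have [-> -> -> ->] := g4E u u0.
have r0 := cbrt_gt0 u0.
rewrite (_ : _ * _ = cbrt u ^+ 2); last by field; rewrite gt_eqF.
by rewrite sqrtr_sqr gtr0_norm.
Qed.

Lemma hodge_base12 u c : 0 < u ->
  hodge (g4 u) (c *: base R (Defs.mset 4 m0110)) = (u * c) *: base R (Defs.mset 4 m1001).
Proof.
move=> u0; rewrite hodge_scale_base sqrt_det_g4// big_mkcond big_ord4 /=.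
have [E0 E1 E2 E3] := g4E u u0; rewrite ?(E0, E1, E2, E3); congr (_ *: _).
rewrite -[X in _ = X * c](cbrtK u u0) /= expr0; field.
by rewrite gt_eqF// cbrt_gt0.
Qed.

Lemma hodge_base03 u c : 0 < u ->
  hodge (g4 u) (c *: base R (Defs.mset 4 m1001)) = (u^-1 * c) *: base R (Defs.mset 4 m0110).
Proof.
move=> u0; rewrite hodge_scale_base sqrt_det_g4// big_mkcond big_ord4 /=.
have [E0 E1 E2 E3] := g4E u u0; rewrite ?(E0, E1, E2, E3); congr (_ *: _).
rewrite -[X in _ = X^-1 * c](cbrtK u u0) /= expr0; field.
by rewrite gt_eqF// cbrt_gt0.
Qed.

Lemma hodge_base123 u c : 0 < u ->
  hodge (g4 u) (c *: base R (Defs.mset 4 m0111)) = (- cbrt u * c) *: base R (Defs.mset 4 m1000).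
Proof.
move=> u0; rewrite hodge_scale_base sqrt_det_g4// big_mkcond big_ord4 /=.
have [E0 E1 E2 E3] := g4E u u0; rewrite ?(E0, E1, E2, E3); congr (_ *: _).
rewrite /= expr1; field.
by rewrite gt_eqF// cbrt_gt0.
Qed.

Lemma set3E : [set 3 : 'I_4]%SET = Defs.mset 4 m0001.
Proof. by apply/finset.setP => -[[|[|[|[|//]]]] lti]; rewrite !inE. Qed.

Lemma hodge_coef3 u b : 0 < u ->
  hodge (g4 u) b [set 3]%SET = cbrt u * b (Defs.mset 4 m1110).
Proof.
move=> u0; rewrite hodge_coef sqrt_det_g4// set3E.
have -> : (~: Defs.mset 4 m0001)%SET = Defs.mset 4 m1110 by rewrite setC_mset.
rewrite sgn_mset -signr_odd (_ : odd _ = false)//.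
rewrite (eq_bigl (fun i : 'I_4 => nth false m1110 i)) => [|i]; last by rewrite inE.
rewrite big_mkcond big_ord4 /=; have [-> -> -> _] := g4E u u0.
rewrite expr0; field.
by rewrite gt_eqF// cbrt_gt0.
Qed.

Lemma ext_scaleE n k (a : ext R n) I : (k *: a) I = k * a I.
Proof. by rewrite ffunE. Qed.

Lemma ext_addE n (a b : ext R n) I : (a + b) I = a I + b I.
Proof. by rewrite ffunE. Qed.

Lemma ext_oppE n (a : ext R n) I : (- a) I = - a I.
Proof. by rewrite ffunE. Qed.

Lemma ext_lin3 n p q r (a b c : ext R n) I x y z :
  a I = x -> b I = y -> c I = z ->
  (p *: a + q *: b - r *: c) I = p * x + q * y - r * z.
Proof. by move=> <- <- <-; rewrite ext_addE ext_addE ext_oppE !ext_scaleE. Qed.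

Lemma ext_deriv_scale_base n (c : 'rV[R]_n -> R) (I : {set 'I_n}) x :
  ext_deriv (fun y => c y *: base R I) x = \sum_(i < n) pderiv i c x *: (dx R i \wedge base R I).
Proof.
apply: eq_bigr => i _; rewrite -wedge_scaler; congr (_ \wedge _).
apply/ffunP => J; rewrite ext_scaleE !ffunE.
have -> : (fun y => (c y *: base R I) J) = (fun y => c y * (J == I)%:R).
  by apply/funext => y; rewrite ext_scaleE ffunE.
case: (J == I) => /=.
  rewrite mulr1; have -> // : (fun y => c y * 1) = c.
  by apply/funext => y; rewrite mulr1.
rewrite mulr0; have -> : (fun y => c y * 0) = cst 0.
  by apply/funext => y; rewrite mulr0.
exact: derive_cst.
Qed.

Lemma sum_dx_base12 (q : 'I_4 -> R) :
  (\sum_(i < 4) q i *: (dx R i \wedge base R (Defs.mset 4 m0110))) (Defs.mset 4 m1110) = q 0.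
Proof.
rewrite sum_ffunE (bigD1 0) //= big1 ?addr0 => [|i /negbTE i0];
  by rewrite ext_scaleE dx_base12 ?i0 ?mulr0 ?mulr1.
Qed.

(** The star sends dx^{03} to a multiple of dx^{12}, and the dx^3-component of the outer star reads
    the dx^{012}-coefficient. Among the dx^i /\ dx^{12} only i = 0 reaches it, so the other partial
    derivatives disappear. *)
Lemma codiff_base03 (u c : 'rV[R]_4 -> R) x : (forall y, 0 < u y) ->
  codiff (fun y => g4 (u y)) (fun y => c y *: base R (Defs.mset 4 m1001)) x [set 3]%SET
  = cbrt (u x) * pderiv 0 (fun y => (u y)^-1 * c y) x.
Proof.
move=> u0; rewrite /codiff {1}/hodge_form hodge_coef3//; congr (_ * _).
rewrite (_ : hodge_form _ _ = fun y => ((u y)^-1 * c y) *: base R (Defs.mset 4 m0110)); last first.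
  by apply/funext => y; rewrite /hodge_form hodge_base03.
by rewrite ext_deriv_scale_base sum_dx_base12.
Qed.

Lemma iprod_scalel n k v (a : ext R n) : iprod (k *: v) a = k *: iprod v a.
Proof.
apply/ffunP => K; rewrite !ffunE scaler_sumr; apply: eq_bigr => I _.
by rewrite mxE /GRing.scale /= !mulrA.
Qed.

Lemma sharp_g4_dx3 u h : 0 < u ->
  sharp (g4 u) (h *: dx R 3) = ((cbrt u ^+ 2)^-1 * h) *: evec R 3.
Proof.
move=> u0; have [_ _ _ g3] := g4E u u0; apply/rowP => i.
rewrite [LHS]mxE ext_scaleE ffunE [RHS]mxE [evec R 3 0 i]mxE eqxx (inj_eq (@set1_inj _)).
by case: eqP => [->|_]; rewrite ?mulr0 // g3 mulrA.
Qed.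

Lemma top_scale n k (a : ext R n) : top (k *: a) = k * top a.
Proof. by rewrite /top ext_scaleE. Qed.

(** The factor 3 arises because each of the three terms in the bracket of [A3] contributes k f
    dx^{0123}; in the last one the two halves are equal. *)
Lemma A3_e3 u f k :
  A3 u (f *: base R (Defs.mset 4 m1001)) (k *: evec R 3) (evec R 3) = (cbrt u)^-1 * (3 * k * f).
Proof.
rewrite /A3; congr (_ * _).
rewrite !iprod_scalel !iprod_scale iprod3_omega1 iprod3_omega2 iprod3_base03.
have sN (b : ext R 4) : - b = (-1) *: b by rewrite scaleN1r.
rewrite !(sN (dx _ _)) !(wedge_scalel, wedge_scaler, scalerA) dx02_omega2.
have -> : dx R 1 \wedge dx R (2 : 'I_4) = base R (Defs.mset 4 m0110) by forms.
rewrite dx21 !(sN (base _ _)) !scalerA -!scalerDl -scalerBl.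
rewrite !(wedge_scalel, wedge_scaler, scalerA) base03_12 -!scalerDl top_scale.
have -> : top (base R (Defs.mset 4 m1111)) = 1.
  rewrite /top ffunE (_ : _ == _)//; apply/eqP/finset.setP => -[[|[|[|[|//]]]] lti];
  by rewrite !inE.
by rewrite /GRing.scale /=; field.
Qed.

(** The forms under the two codifferentials are h^2/u dx^{03} and its opposite ([b1], [b2]), so
    their weights 1 and -2 add up to 3. The prefactor u^{2/3} meets the u^{1/3} of the outer star,
    which gives 3 u. Derivability of the quotient lets the minus sign leave the derivative. *)
Lemma geodesic_rhs3 (u h : 'rV[R]_4 -> R) x f : (forall y, 0 < u y) ->
  derivable (fun y => h y ^+ 2 / u y ^+ 2) x (evec R 0) ->
  ext_deriv (fun y => h y *: dx R 3) x = f *: base R (Defs.mset 4 m1001) ->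
  geodesic_rhs u (fun y => h y *: dx R 3) x [set 3]%SET =
  6 * f * h x / u x + 3 * u x * pderiv 0 (fun y => h y ^+ 2 / u y ^+ 2) x.
Proof.
move=> u0 dq dh.
have r0 y : cbrt (u y) != 0 by rewrite gt_eqF// cbrt_gt0.
have i1 y : iprod (sharp (g4 (u y)) (h y *: dx R 3)) (omega1 R) =
    (- ((cbrt (u y) ^+ 2)^-1 * h y)) *: dx R 2.
  by rewrite sharp_g4_dx3// iprod_scalel iprod3_omega1 scalerN scaleNr.
have i2 y : iprod (sharp (g4 (u y)) (h y *: dx R 3)) (omega2 R) =
    ((cbrt (u y) ^+ 2)^-1 * h y) *: dx R 1.
  by rewrite sharp_g4_dx3// iprod_scalel iprod3_omega2.
pose g y := g4 (u y).
pose a : diff_form R 4 := fun y => h y *: dx R 3.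
pose j1 y := iprod (sharp (g y) (a y)) (omega1 R).
pose j2 y := iprod (sharp (g y) (a y)) (omega2 R).
have b1 : hodge_form g (fun y => u y `^ (- (2 / 3)) *: (j1 y \wedge j2 y)) =
    fun y => (h y ^+ 2 / u y) *: base R (Defs.mset 4 m1001).
  apply/funext => y; rewrite /hodge_form /j1 /j2 i1 i2 !(wedge_scalel, wedge_scaler) dx21.
  rewrite -(scaleN1r (base _ _)) !scalerA hodge_base12//; congr (_ *: _).
  by rewrite powRN23// -[X in X * _](cbrtK (u y))// -[X in _ / X](cbrtK (u y))//; field.
have b2 : (fun z => a z \wedge hodge_form g
      (fun y => u y `^ (- (2 / 3)) *: (j1 y \wedge omega2 R)) z) =
    fun y => (- (h y ^+ 2 / u y)) *: base R (Defs.mset 4 m1001).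
  apply/funext => y; rewrite /hodge_form /j1 i1 !wedge_scalel dx2_omega2 scalerA hodge_base123//.
  rewrite wedge_scaler dx30 -(scaleN1r (base _ _)) !scalerA; congr (_ *: _).
  by rewrite powRN23// -[X in _ / X](cbrtK (u y))//; field.
rewrite -[geodesic_rhs _ _ _]/(2 *: iA3 u a x
    + u x `^ (2 / 3) *: codiff g (hodge_form g (fun y => u y `^ (- (2 / 3)) *: (j1 y \wedge j2 y))) x
    - (2 * u x `^ (2 / 3)) *: codiff g (fun z => a z \wedge hodge_form g
      (fun y => u y `^ (- (2 / 3)) *: (j1 y \wedge omega2 R)) z) x) b1 b2.
have C1 := codiff_base03 u (fun y => h y ^+ 2 / u y) x u0.
have C2 := codiff_base03 u (fun y => - (h y ^+ 2 / u y)) x u0.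
have C0 : iA3 u a x [set 3]%SET = 3 * f * h x / u x.
  rewrite /iA3 sum_ffunE (bigD1 3) //= big1 ?addr0 => [|i i3].
    rewrite ext_scaleE ffunE eqxx mulr1 dh sharp_g4_dx3// A3_e3.
    by rewrite -[X in _ / X](cbrtK (u x))//; field.
  by rewrite ext_scaleE ffunE (inj_eq (@set1_inj _)) eq_sym (negbTE i3) mulr0.
rewrite (ext_lin3 _ _ _ _ _ _ _ _ _ _ _ C0 C1 C2).
have -> : (fun y => (u y)^-1 * (h y ^+ 2 / u y)) = (fun y => h y ^+ 2 / u y ^+ 2).
  by apply/funext => y; field; rewrite gt_eqF.
have -> : pderiv 0 (fun y => (u y)^-1 * - (h y ^+ 2 / u y)) x =
    - pderiv 0 (fun y => h y ^+ 2 / u y ^+ 2) x.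
  have -> : (fun y => (u y)^-1 * - (h y ^+ 2 / u y)) = - (fun y => h y ^+ 2 / u y ^+ 2).
    by apply/funext => y; rewrite fctE; field; rewrite gt_eqF.
  exact: deriveN.
move: (pderiv _ _ _) => q.
have u3 := cbrtK (u x) (u0 x).
have -> : 3 * u x * q = 3 * cbrt (u x) ^+ 3 * q by rewrite u3.
by rewrite powR23//; field; rewrite gt_eqF.
Qed.

End Forms.

(** * Smooth paths of functions *)

Section Smooth.
Context {R : realType}.

(** A directional derivative sees only the restriction to a line. The rules for powers therefore
    follow from the one-variable chain rule, without total differentiability of [g]. *)
Lemma is_derive_line {W : normedModType R} {g : W -> R} {x v : W} {d : R} :
  is_derive x v g d <-> is_derive (0 : R) (1 : R) (fun k => g (k *: v + x)) d.
Proof.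
have E : (fun k : R => k^-1 *: ((g \o shift x) (k *: v) - g x)) =
    (fun k : R => k^-1 *: (((fun k => g (k *: v + x)) \o shift 0) (k *: (1 : R)) -
       (fun k => g (k *: v + x)) 0)).
  apply/funext => k /=; rewrite addr0 scale0r add0r.
  by rewrite /GRing.scale /= mulr1.
by split=> -[D1 D2]; split; rewrite /derivable /derive ?E// -?E.
Qed.

Lemma is_derive_chain {W : normedModType R} {p : R -> R} {g : W -> R} {x v : W} {a b : R} :
  is_derive (g x) (1 : R) p a -> is_derive x v g b ->
  is_derive x v (fun y => p (g y)) (a * b).
Proof.
move=> dp /is_derive_line dg; apply/is_derive_line.
by apply: (@is_derive1_comp _ p (fun k => g (k *: v + x))); rewrite ?scale0r ?add0r.
Qed.

Lemma is_derive_powR {W : normedModType R} (g : W -> R) (x v : W) (a b : R) :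
  0 < g x -> is_derive x v g b ->
  is_derive x v (fun y => g y `^ a) (a * g x `^ (a - 1) * b).
Proof. by move=> gx0; exact: is_derive_chain (@is_derive1_powR R a (g x) gx0). Qed.

Lemma is_derive_div {W : normedModType R} (g k : W -> R) (x v : W) (dg dk : R) :
  k x != 0 -> is_derive x v g dg -> is_derive x v k dk ->
  is_derive x v (fun y => g y / k y) (dg / k x - g x * dk / k x ^+ 2).
Proof.
move=> kx0 Dg [Dk1 Dk2].
have Dk : is_derive x v (fun y => (k y)^-1) (- (k x) ^- 2 * dk).
  by split; [exact: derivableV|rewrite deriveV// Dk2].
apply: is_derive_eq (is_deriveM Dg Dk) _.
by rewrite /GRing.scale /=; field.
Qed.

Lemma continuous_powR (a x : R) : 0 < x -> {for x, continuous (@powR R ^~ a)}.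
Proof.
move=> x0; have [D _] := is_derive1_powR a x0.
exact: differentiable_continuous (iffLR (derivable1_diffP _ _) D).
Qed.

(** Here and in [dspace] the partial derivative is a directional derivative of the uncurried
    function on space-time. In this form [Ck_on] itself says that the derivative of a smooth path is
    a smooth path. *)
Definition dtime {n} (g : R -> 'rV[R]_n -> R) (t : R) (x : 'rV[R]_n) : R :=
  'D_((1, 0) : R^o * 'rV[R]_n) (fun p : R^o * 'rV[R]_n => g p.1 p.2) (t, x).

Definition dspace {n} (i : 'I_n) (g : R -> 'rV[R]_n -> R) (t : R) (x : 'rV[R]_n) : R :=
  'D_((0, evec R i) : R^o * 'rV[R]_n) (fun p : R^o * 'rV[R]_n => g p.1 p.2) (t, x).

Lemma smooth_on_derive (W : normedModType R) (A : set W) (g : W -> R) v :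
  smooth_on A g -> smooth_on A (fun x => 'D_v g x).
Proof. by move=> sg k; have [_] := sg k.+1; apply. Qed.

Section Path.
Variables (n : nat) (J : set R).
Implicit Types g : R -> 'rV[R]_n -> R.

Lemma smooth_path_derive v g : smooth_path J g ->
  smooth_path J (fun t x => 'D_v (fun p : R^o * 'rV[R]_n => g p.1 p.2) (t, x)).
Proof.
by rewrite /smooth_path => /(@smooth_on_derive _ _ _ v).
Qed.

Lemma smooth_path_dtime g : smooth_path J g -> smooth_path J (dtime g).
Proof. exact: smooth_path_derive. Qed.

Lemma smooth_path_dspace i g : smooth_path J g -> smooth_path J (dspace i g).
Proof. exact: smooth_path_derive. Qed.

Lemma smooth_path_continuous2 g : smooth_path J g -> forall t, J t -> continuous2 g t.
Proof. by move=> sg t Jt x; exact: (sg 0%N (t, x) Jt). Qed.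

Lemma smooth_path_derivable v g : smooth_path J g -> forall t x, J t ->
  derivable (fun p : R^o * 'rV[R]_n => g p.1 p.2) (t, x) v.
Proof.
by move=> sg t x Jt; have [D _] := sg 1%N; apply: diff_derivable; exact: D.
Qed.

Lemma is_derive_dtime g t x : smooth_path J g -> J t ->
  is_derive t (1 : R) (g ^~ x) (dtime g t x).
Proof.
move=> sg Jt; have D := smooth_path_derivable (1, 0) _ sg t x Jt.
have /is_derive_line Dl := derivableP D; apply/is_derive_line; move: Dl.
rewrite -/(dtime g t x); congr (is_derive _ _ _ _); apply/funext => k /=.
by rewrite scaler0 add0r.
Qed.

Lemma is_derive_dspace i g t x : smooth_path J g -> J t ->
  is_derive x (evec R i) (g t) (dspace i g t x).
Proof.
move=> sg Jt; have D := smooth_path_derivable (0, evec R i) _ sg t x Jt.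
have /is_derive_line Dl := derivableP D; apply/is_derive_line; move: Dl.
rewrite -/(dspace i g t x); congr (is_derive _ _ _ _); apply/funext => k /=.
by rewrite scaler0 add0r.
Qed.

End Path.

Lemma continuous2M {P Q : topologicalType} (F G : P -> Q -> R) p :
  continuous2 F p -> continuous2 G p -> continuous2 (fun p q => F p q * G p q) p.
Proof. by move=> cF cG q; apply: cvgM; [exact: cF|exact: cG]. Qed.

Lemma continuous2D {P Q : topologicalType} (F G : P -> Q -> R) p :
  continuous2 F p -> continuous2 G p -> continuous2 (fun p q => F p q + G p q) p.
Proof. by move=> cF cG q; apply: cvgD; [exact: cF|exact: cG]. Qed.

Lemma continuous2_fun {P Q : topologicalType} (f : Q -> R) (p : P) :
  continuous f -> continuous2 (fun=> f) p.
Proof.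
by move=> cf q; apply: (@cvg_comp _ _ _ snd f _ (nbhs q)); [exact: cvg_snd|exact: cf].
Qed.

Lemma continuous2_powR {P Q : topologicalType} (a : R) (F : P -> Q -> R) p :
  (forall q, 0 < F p q) -> continuous2 F p -> continuous2 (fun p q => F p q `^ a) p.
Proof.
move=> F0 cF q; apply: (@cvg_comp _ _ _ (fun z : P * Q => F z.1 z.2) (@powR R ^~ a)
  _ (nbhs (F p q))); first exact: cF.
exact: continuous_powR.
Qed.

Lemma continuous2_xpart {P : topologicalType} (F : P -> 'rV[R]_4 -> R) p :
  continuous2 F p -> continuous2 (fun p (q : 'rV[R]_7) => F p (xpart q)) p.
Proof.
move=> cF q; apply: (@cvg_comp _ _ _ (fun z : P * 'rV[R]_7 => (z.1, xpart z.2))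
  (fun z => F z.1 z.2) _ (nbhs (p, xpart q))); last exact: cF.
apply: cvg_pair_nbhs; first exact: cvg_fst.
apply: (@cvg_comp _ _ _ snd (@xpart R) _ (nbhs q)); first exact: cvg_snd.
exact: (@continuous_lsubmx R 1 4 3).
Qed.

(** The coordinates of M begin with those of T^4, so the direction e_0 of M projects to the
    direction e_0 of T^4. *)
Lemma xpartD (p : 'rV[R]_(4 + 3)) k :
  xpart (k *: (evec R 0 : 'rV[R]_7) + p) = k *: evec R 0 + xpart p.
Proof. by apply/rowP => i; rewrite !mxE. Qed.

Lemma is_derive_xpart (g : 'rV[R]_4 -> R) (p : 'rV[R]_7) d :
  is_derive (xpart p) (evec R 0) g d ->
  is_derive p (evec R 0) (fun q => g (xpart q)) d.
Proof.
move=> /is_derive_line D; apply/is_derive_line; move: D.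
by congr (is_derive _ _ _ _); apply/funext => k; rewrite xpartD.
Qed.

(** The second-derivative test for convexity is applied to [- V] between s and t, a segment that
    stays in [J] because [J] is an interval. The case t < s follows by exchanging the end points and
    replacing c by 1 - c. *)
Lemma concave_second_derivative (J : set R) (V V1 V2 : R -> R) :
  is_interval J ->
  (forall t, J t -> is_derive t (1 : R) V (V1 t)) ->
  (forall t, J t -> is_derive t (1 : R) V1 (V2 t)) ->
  (forall t, J t -> V2 t <= 0) ->
  forall s t c : R, J s -> J t -> 0 <= c <= 1 ->
    c * V s + (1 - c) * V t <= V (c * s + (1 - c) * t).
Proof.
move=> iJ dV dV1 V20.
have main s t c : s <= t -> J s -> J t -> 0 <= c <= 1 ->
    c * V s + (1 - c) * V t <= V (c * s + (1 - c) * t).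
  move=> st Js Jt /andP[c0 c1].
  have Jx x : s <= x <= t -> J x by move=> ?; exact: (iJ s t).
  have JI x : x \in `]s, t[%R -> J x.
    by rewrite in_itv /= => /andP[/ltW sx /ltW xt]; apply: Jx; rewrite sx.
  have cV x : J x -> {for x, continuous V}.
    move=> /dV[D _]; exact: differentiable_continuous (iffLR (derivable1_diffP _ _) D).
  have dN x : J x -> is_derive x (1 : R) (- V) (- V1 x).
    by move=> Jx'; have := dV x Jx'; exact: is_deriveN.
  have dDN x : x \in `]s, t[%R -> is_derive x (1 : R) ('D_1 (- V)) (- V2 x).
    (* The derivative of [- V] is known to be [- V1] only at points of [J]; the open interval ]s, t[
       provides a neighbourhood of such points. *)
    move=> xst; apply: (@near_eq_is_derive _ _ _ (- V1)).
      near=> y; have Jy : J y by apply: JI; near: y; exact: near_in_itvoo.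
      by have [_ ->] := dN y Jy.
    by apply: is_deriveN; exact: dV1 (JI x xst).
  have D2 x : s < x < t -> 0 <= 'D_1 ('D_1 (- V)) x.
    move=> xst; have [|_ ->] := dDN x; first by rewrite in_itv.
    by rewrite oppr_ge0; apply/V20/JI; rewrite in_itv.
  have cl : (- V) x @[x --> t^'-] --> (- V) t.
    by apply/cvg_at_left_filter; apply: cvgN; exact: cV.
  have cr : (- V) x @[x --> s^'+] --> (- V) s.
    by apply/cvg_at_right_filter; apply: cvgN; exact: cV.
  have d1 : {in `]s, t[%R, forall x, derivable (- V) x 1} by move=> x /JI /dN[].
  have d2 : {in `]s, t[%R, forall x, derivable ('D_1 (- V)) x 1} by move=> x /dDN[].
  have := @second_derivative_convex R (- V) s t D2 cl cr d1 d2 (Itv01 c0 c1) st.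
  by rewrite !convRE /= /unstable.onem !fctE; lra.
move=> s t c Js Jt c01; have [st|/ltW ts] := leP s t; first exact: main.
have := main t s (1 - c) ts Jt Js; have -> : 1 - (1 - c) = c by ring.
by rewrite (addrC (c * V s)) (addrC (c * s)); apply; move: c01; lra.
Unshelve. all: by end_near. Qed.

End Smooth.

(** * The second variation of the volume *)

Section Volume.
Context {R : realType}.

Lemma continuous_xpart (f : 'rV[R]_4 -> R) :
  continuous f -> continuous (fun p : 'rV[R]_7 => f (xpart p)).
Proof.
move=> cf p; apply: (@cvg_comp _ _ _ (@xpart R) f _ (nbhs (xpart p))); last exact: cf.
exact: (@continuous_lsubmx R 1 4 3).
Qed.

Lemma continuous_mulf (T : topologicalType) (f g : T -> R) :
  continuous f -> continuous g -> continuous (fun x => f x * g x).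
Proof. by move=> cf cg x; exact: cvgM (cf x) (cg x). Qed.

Lemma continuous_addf (T : topologicalType) (f g : T -> R) :
  continuous f -> continuous g -> continuous (fun x => f x + g x).
Proof. by move=> cf cg x; exact: cvgD (cf x) (cg x). Qed.

Lemma powRN53 (v : R) : 0 < v -> v `^ (- (5 / 3)) = (cbrt v ^+ 5)^-1.
Proof.
move=> v0; rewrite powRN /cbrt -[in RHS]powR_mulrn ?powR_ge0// -powRrM.
by congr (_ `^ _)^-1; field.
Qed.

Definition vol_dt (u : R -> 'rV[R]_4 -> R) t x :=
  3^-1 * u t x `^ (- (2 / 3)) * dtime u t x.

Definition vol_dtt (u : R -> 'rV[R]_4 -> R) t x :=
  3^-1 * (- (2 / 3) * u t x `^ (- (5 / 3)) * dtime u t x * dtime u t x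
          + u t x `^ (- (2 / 3)) * dtime (dtime u) t x).

Section Geodesic.
Variables (J : set R) (u h : R -> 'rV[R]_4 -> R).
Hypotheses (oJ : open J) (su : smooth_path J u) (sh : smooth_path J h)
  (u_gt0 : forall t, J t -> forall x, 0 < u t x)
  (pu : forall t, J t -> torus_periodic (u t))
  (ph : forall t, J t -> torus_periodic (h t)).

Let cu t : J t -> continuous2 u t. Proof. exact: smooth_path_continuous2. Qed.

Let cpow a t : J t -> continuous2 (fun t x => u t x `^ a) t.
Proof. by move=> Jt; apply: continuous2_powR; [exact: u_gt0|exact: cu]. Qed.

Let ccst a t : continuous2 (fun (_ : R) (_ : 'rV[R]_4) => a : R) t.
Proof. by apply: (continuous2_fun (fun=> a)); exact: cst_continuous. Qed.

Let cut t : J t -> continuous2 (dtime u) t.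
Proof. by apply: smooth_path_continuous2; exact: smooth_path_dtime. Qed.

Lemma continuous2_vol_dt t : J t -> continuous2 (vol_dt u) t.
Proof.
move=> Jt; apply: continuous2M; last exact: (cut _ Jt).
by apply: continuous2M; [exact: ccst|exact: (cpow _ _ Jt)].
Qed.

Lemma continuous2_vol_dtt t : J t -> continuous2 (vol_dtt u) t.
Proof.
move=> Jt; apply: continuous2M; first exact: ccst.
apply: continuous2D; apply: continuous2M.
- apply: continuous2M; last exact: (cut _ Jt).
  by apply: continuous2M; [exact: ccst|exact: (cpow _ _ Jt)].
- exact: (cut _ Jt).
- exact: (cpow _ _ Jt).
- by apply: smooth_path_continuous2 Jt; do 2 apply: smooth_path_dtime.
Qed.

(** The lowered exponent is a separate argument so that it appears in the form -(2/3) or -(5/3) used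
    in [vol_dt], [vol_dtt] and [wx]. *)
Let dpow (W : normedModType R) a b (g : W -> R) x v d : a - 1 = b ->
  0 < g x -> is_derive x v g d -> is_derive x v (fun y => g y `^ a) (a * g x `^ b * d).
Proof. by move=> <-; exact: is_derive_powR. Qed.

Lemma is_derive_vol t x : J t ->
  is_derive t (1 : R) (fun s => u s x `^ (1 / 3)) (vol_dt u t x).
Proof.
move=> Jt; apply: is_derive_eq.
  apply: (dpow _ _ (- (2 / 3)) (u ^~ x)); first by field.
    exact: u_gt0.
  exact: is_derive_dtime.
by rewrite div1r.
Qed.

Lemma is_derive_vol_dt t x : J t ->
  is_derive t (1 : R) (fun s => vol_dt u s x) (vol_dtt u t x).
Proof.
move=> Jt.
have D1 : is_derive t (1 : R) (fun s => u s x `^ (- (2 / 3)))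
    (- (2 / 3) * u t x `^ (- (5 / 3)) * dtime u t x).
  apply: (dpow _ _ _ (u ^~ x)); first by field.
    exact: u_gt0.
  exact: is_derive_dtime.
have D2 : is_derive t (1 : R) (dtime u ^~ x) (dtime (dtime u) t x).
  by apply: is_derive_dtime Jt; exact: smooth_path_dtime.
have -> : (fun s => vol_dt u s x) =
    3^-1 *: ((fun s => u s x `^ (- (2 / 3))) * (dtime u ^~ x)).
  by apply/funext => s; rewrite /vol_dt !fctE /GRing.scale /= mulrA.
apply: is_derive_eq (is_deriveZ _ (is_deriveM D1 D2)) _.
by rewrite /vol_dtt /GRing.scale /=; ring.
Qed.

(* The weight is frozen at the time t0, so that differentiating the integration
   by parts in t never exchanges d_t and d_0. *)
Let w t0 x := u t0 x `^ (- (2 / 3)).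
Let wx t0 x := - (2 / 3) * u t0 x `^ (- (5 / 3)) * dspace 0 u t0 x.

Let cw t0 : J t0 -> continuous (w t0).
Proof. by move=> Jt; exact: continuous2_r (cpow _ _ Jt). Qed.

Let cwx t0 : J t0 -> continuous (wx t0).
Proof.
move=> Jt; apply: (continuous2_r (F := wx)).
apply: continuous2M; first by apply: continuous2M; [exact: ccst|exact: (cpow _ _ Jt)].
by apply: smooth_path_continuous2 Jt; exact: smooth_path_dspace.
Qed.

Let is_derive_w t0 x : J t0 -> is_derive x (evec R 0) (w t0) (wx t0 x).
Proof.
move=> Jt; apply: (dpow _ _ _ (u t0)); first by field.
  exact: u_gt0.
exact: is_derive_dspace.
Qed.

Lemma xpart_evec0 (p : 'rV[R]_7) : xpart (p + evec R 0) = xpart p + evec R 0.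
Proof. by rewrite addrC -[X in xpart (X + _)]scale1r xpartD scale1r addrC. Qed.

(** The integrand is the x^0-derivative of the periodic function w(t0) h(t). The two times are
    independent, so the identity can be differentiated in t alone. *)
Lemma cube_int_by_parts t0 t : J t0 -> J t ->
  cube_int (fun p : 'rV[R]_7 => w t0 (xpart p) * dspace 0 h t (xpart p)
     + wx t0 (xpart p) * h t (xpart p)) = 0.
Proof.
move=> Jt0 Jt.
have ch : continuous (h t) := continuous2_r (smooth_path_continuous2 _ _ _ sh t Jt).
have chx : continuous (dspace 0 h t).
  apply: continuous2_r.
  by apply: smooth_path_continuous2 Jt; exact: smooth_path_dspace.
apply: (cube_int_pderiv0 6 (fun p => w t0 (xpart p) * h t (xpart p))).
- by apply: (continuous_xpart (fun x => w t0 x * h t x)); apply: continuous_mulf; [exact: cw|exact: ch].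
- apply: (continuous_xpart (fun x => w t0 x * dspace 0 h t x + wx t0 x * h t x)).
  by apply: continuous_addf; apply: continuous_mulf; [exact: cw|exact: chx|exact: cwx|exact: ch].
- move=> p; apply: (is_derive_xpart (w t0 * h t)).
  apply: is_derive_eq (is_deriveM (is_derive_w t0 (xpart p) Jt0) (is_derive_dspace _ _ 0 _ _ _ sh Jt)) _.
  by rewrite /GRing.scale /=; ring.
- by move=> p; rewrite xpart_evec0 /w pu// ph.
Qed.

(** With the weight fixed at t, the integral of [cube_int_by_parts] vanishes for every time s in the
    open set [J]; its derivative at s = t is therefore 0. *)
Lemma cube_int_by_parts_dtime t : J t ->
  cube_int (fun p : 'rV[R]_7 => w t (xpart p) * dtime (dspace 0 h) t (xpart p)
     + wx t (xpart p) * dtime h t (xpart p)) = 0.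
Proof.
move=> Jt.
have shx := smooth_path_dspace _ _ 0 _ sh.
have cont g : smooth_path J g -> forall s, J s ->
    continuous2 (fun s x => w t x * g s x) s /\ continuous2 (fun s x => wx t x * g s x) s.
  move=> sg s Js; have cg := smooth_path_continuous2 _ _ _ sg s Js.
  by split; apply: continuous2M => //; apply: continuous2_fun; [exact: cw|exact: cwx].
have [_ D] : is_derive t (1 : R)
    (fun s => cube_int (fun p : 'rV[R]_7 => w t (xpart p) * dspace 0 h s (xpart p)
     + wx t (xpart p) * h s (xpart p)))
    (cube_int (fun p : 'rV[R]_7 => w t (xpart p) * dtime (dspace 0 h) t (xpart p)
     + wx t (xpart p) * dtime h t (xpart p))).
  apply: (is_derive_cube_int 7 J
    (fun s p => w t (xpart p) * dspace 0 h s (xpart p) + wx t (xpart p) * h s (xpart p))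
    (fun s p => w t (xpart p) * dtime (dspace 0 h) s (xpart p)
       + wx t (xpart p) * dtime h s (xpart p))) => //.
  - move=> s Js; apply: (continuous2_xpart (fun s x => w t x * dspace 0 h s x + wx t x * h s x)).
    by apply: continuous2D; [have [] := cont _ shx s Js|have [] := cont _ sh s Js].
  - move=> s Js; apply: (continuous2_xpart
      (fun s x => w t x * dtime (dspace 0 h) s x + wx t x * dtime h s x)).
    by apply: continuous2D; [have [] := cont _ (smooth_path_dtime _ _ _ shx) s Js
      |have [] := cont _ (smooth_path_dtime _ _ _ sh) s Js].
  move=> s p Js.
  have D1 := is_derive_dtime _ _ _ _ (xpart p) shx Js.
  have D2 := is_derive_dtime _ _ _ _ (xpart p) sh Js.
  exact: (is_deriveD (is_deriveZ (w t (xpart p)) D1) (is_deriveZ (wx t (xpart p)) D2)).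
rewrite -{}D; apply: (@etrans _ _ ('D_1 (cst (0 : R)) t)); last exact: derive_cst.
apply: near_eq_derive.
near=> s; rewrite cube_int_by_parts//; near: s; exact: open_nbhs_nbhs.
Unshelve. all: by end_near. Qed.

Hypotheses
  (h_x : forall t x, J t -> dspace 0 h t x = dtime u t x)
  (h_t : forall t x, J t -> dtime h t x =
     2 * dtime u t x * h t x / u t x - dspace 0 u t x * h t x ^+ 2 / u t x ^+ 2).

(** The normalisation d_0 h = d_t u holds at all times of the open set [J], so it may be
    differentiated in t; symmetry of mixed derivatives does not enter. *)
Lemma dtime_dspace t x : J t -> dtime (dspace 0 h) t x = dtime (dtime u) t x.
Proof.
move=> Jt.
have [_ <-] := is_derive_dtime _ _ _ _ x (smooth_path_dspace _ _ 0 _ sh) Jt.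
have [_ <-] := is_derive_dtime _ _ _ _ x (smooth_path_dtime _ _ _ su) Jt.
apply: near_eq_derive.
near=> s; rewrite h_x//; near: s; exact: open_nbhs_nbhs.
Unshelve. all: by end_near. Qed.

Lemma cube_int_vol_dtt t : J t ->
  9 * cube_int (fun p : 'rV[R]_7 => vol_dtt u t (xpart p)) =
  - 2 * cube_int (fun p : 'rV[R]_7 => let x := xpart p in
    ((u t x)^-1 * dtime u t x - u t x ^- 2 * dspace 0 u t x * h t x) ^+ 2 * u t x `^ (1 / 3)).
Proof.
move=> Jt.
have cd : continuous (fun p : 'rV[R]_7 => vol_dtt u t (xpart p)).
  exact: continuous_xpart (continuous2_r (continuous2_vol_dtt _ Jt)).
pose B x := w t x * dtime (dspace 0 h) t x + wx t x * dtime h t x.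
have cB : continuous (fun p : 'rV[R]_7 => B (xpart p)).
  apply: (continuous_xpart B); apply: continuous_addf; apply: continuous_mulf.
  - exact: cw.
  - apply: (continuous2_r (F := dtime (dspace 0 h))).
    by apply: smooth_path_continuous2 Jt; exact/smooth_path_dtime/smooth_path_dspace.
  - exact: cwx.
  - apply: (continuous2_r (F := dtime h)).
    by apply: smooth_path_continuous2 Jt; exact: smooth_path_dtime.
pose G x := ((u t x)^-1 * dtime u t x - u t x ^- 2 * dspace 0 u t x * h t x) ^+ 2 * u t x `^ (1 / 3).
(* The integral of [B] is 0, and its factor 3/2 is chosen to cancel the second time derivative of u
   in -(9/2) [vol_dtt]. What remains is u^{-5/3} (f^2 - u_0 h_t), and the formula for h_t turns the
   bracket into (f - u_0 h / u)^2. *)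
have E x : G x = - (9 / 2) * vol_dtt u t x + 3 / 2 * B x.
  rewrite /G /B /vol_dtt /w /wx dtime_dspace// h_t// powRN23 ?u_gt0// powRN53 ?u_gt0//.
  have r0 : cbrt (u t x) != 0 by rewrite gt_eqF// cbrt_gt0 ?u_gt0.
  have := cbrtK (u t x) (u_gt0 _ Jt x); rewrite -/(cbrt (u t x)).
  by move: (cbrt _) r0 => r r0 <-; field.
rewrite -/(cube_int (fun p : 'rV[R]_7 => G (xpart p))).
have -> : (fun p : 'rV[R]_7 => G (xpart p)) =
    (fun p => - (9 / 2) * vol_dtt u t (xpart p) + 3 / 2 * B (xpart p)).
  by apply/funext => p; exact: E.
rewrite cube_intD.
- rewrite (cube_intZ _ _ (fun p => vol_dtt u t (xpart p)) cd).
  rewrite (cube_intZ _ _ (fun p => B (xpart p)) cB).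
  by rewrite cube_int_by_parts_dtime//; field.
- by apply: continuous_mulf; [exact: cst_continuous|exact: cd].
- by apply: continuous_mulf; [exact: cst_continuous|exact: cB].
Qed.

End Geodesic.
End Volume.

(** * From the hypotheses on forms to the functions u and h *)

Lemma one_form_dx3 (R : realType) (a : ext R 4) : homogeneous 1 a ->
  a [set 0]%SET = 0 -> a [set 1]%SET = 0 -> a [set 2]%SET = 0 ->
  a = a [set 3]%SET *: dx R 3.
Proof.
move=> a1 a_0 a_1 a_2; apply/ffunP => I; rewrite ext_scaleE ffunE.
have [/cards1P[i ->]|I1] := boolP (#|I| == 1%N); last first.
  rewrite (a1 I)//; case: eqP => [I3|_]; last by rewrite mulr0.
  by rewrite I3 cards1 in I1.
rewrite (inj_eq (@set1_inj _)).
case: eqP => [->|i3]; first by rewrite mulr1.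
rewrite mulr0; case: i i3 => -[|[|[|[|//]]]] lti i3.
- by rewrite (_ : Ordinal lti = 0)//; apply: val_inj.
- by rewrite (_ : Ordinal lti = 1)//; apply: val_inj.
- by rewrite (_ : Ordinal lti = 2)//; apply: val_inj.
- by case: i3; apply: val_inj.
Qed.

Lemma dt_omega3E (R : realType) (u : R -> 'rV[R]_4 -> R) t x d :
  is_derive t (1 : R) (u ^~ x) d ->
  dt (fun s y => omega3 (u s y)) t x = d *: base R (Defs.mset 4 m1001).
Proof.
move=> D; apply/ffunP => I; rewrite ext_scaleE ffunE /dt_fun.
have -> : (fun s => omega3 (u s x) I) =
    (u ^~ x) * cst (base R (Defs.mset 4 m1001) I) + cst ((dx R 1 \wedge dx R (2 : 'I_4)) I).
  by apply/funext => s; rewrite /omega3 ext_addE ext_scaleE dx03.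
have [_ De] := is_deriveD (is_deriveM D (is_derive_cst (base R (Defs.mset 4 m1001) I) t (1 : R)))
  (is_derive_cst ((dx R 1 \wedge dx R (2 : 'I_4)) I) t (1 : R)).
by rewrite derive1E De scaler0 add0r addr0 /GRing.scale /= mulrC.
Qed.

Lemma top_vol_phi (R : realType) (v : 'rV[R]_4 -> R) k (p : 'rV[R]_(4 + 3)) : 0 < v (xpart p) ->
  top (k *: vol_form (phi v) p) = k * v (xpart p) `^ (1 / 3).
Proof.
by move=> v0; rewrite G2_vol_phi// !top_scale /top ffunE eqxx mulr1.
Qed.

Theorem proposition5p5 (R : realType) (J : set R)
    (u : R -> 'rV[R]_4 -> R) (alpha : R -> diff_form R 4)
    (openJ : open J) (intervalJ : is_interval J)
    (u_smooth : smooth_path J u)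
    (u_periodic : forall t, J t -> torus_periodic (u t))
    (u_x0x3 : forall t, J t -> forall x y : 'rV[R]_4,
       x 0 0 = y 0 0 -> x 0 3 = y 0 3 -> u t x = u t y)
    (u_gt0 : forall t, J t -> forall x, 0 < u t x)
    (alpha_1form : forall t, J t -> forall x, homogeneous 1 (alpha t x))
    (alpha_smooth : forall I : {set 'I_4},
       smooth_path J (fun t x => alpha t x I))
    (alpha_periodic : forall t, J t -> forall I : {set 'I_4},
       torus_periodic (fun x => alpha t x I))
    (dt_omega3 : forall t, J t -> forall x,
       dt (fun s y => omega3 (u s y)) t x = ext_deriv (alpha t) x)
    (geodesic : forall t, J t -> forall x,
       6 *: dt alpha t x = geodesic_rhs (u t) (alpha t) x)
    (normalised_alpha : forall t, J t -> forall x,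
       [/\ component 0 (alpha t) x = 0, component 1 (alpha t) x = 0,
           component 2 (alpha t) x = 0
         & pderiv 0 (component 3 (alpha t)) x = dt_fun u t x]) :
  let V : R -> R := fun t => Vol (phi (u t)) in
  (forall t, J t ->
     [/\ derivable V t 1, derivable (derive1 V) t 1,
         9 * derive1n 2 V t =
         - 2 * torus_int (fun p => let x := xpart p in
           ((u t x)^-1 * dt_fun u t x
            - (u t x) ^- 2 * pderiv 0 (u t) x * component 3 (alpha t) x) ^+ 2
           *: vol_form (phi (u t)) p)
       & 9 * derive1n 2 V t =
         - 2 * torus_int (fun p => let x := xpart p in
           (pderiv 0 (fun y => component 3 (alpha t) y / u t y) x) ^+ 2
           *: vol_form (phi (u t)) p)]) /\
  (forall s t c : R, J s -> J t -> 0 <= c <= 1 ->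
     c * V s + (1 - c) * V t <= V (c * s + (1 - c) * t)).
Proof.
move=> V.
pose h t x := component 3 (alpha t) x.
have su := u_smooth.
have sh : smooth_path J h := alpha_smooth [set 3]%SET.
have alphaE t : J t -> alpha t = fun x => h t x *: dx R 3.
  move=> Jt; apply/funext => x; have [a_0 a_1 a_2 _] := normalised_alpha t Jt x.
  by apply: one_form_dx3 => //; exact: alpha_1form.
have dtuE t x : J t -> dt_fun u t x = dtime u t x.
  by move=> Jt; rewrite /dt_fun derive1E; have [_ ->] := is_derive_dtime _ _ _ _ x su Jt.
have dxuE t x : J t -> pderiv 0 (u t) x = dspace 0 u t x.
  by move=> Jt; rewrite /pderiv; have [_ ->] := is_derive_dspace _ _ 0 _ _ x su Jt.
have h_x t x : J t -> dspace 0 h t x = dtime u t x.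
  move=> Jt; rewrite -dtuE//; have [_ _ _ <-] := normalised_alpha t Jt x.
  by rewrite /pderiv; have [_ ->] := is_derive_dspace _ _ 0 _ _ x sh Jt.
have u0 t x : J t -> u t x != 0 by move=> Jt; rewrite gt_eqF// u_gt0.
have dq t x : J t -> is_derive x (evec R 0) (fun y => h t y / u t y)
    (dtime u t x / u t x - h t x * dspace 0 u t x / u t x ^+ 2).
  move=> Jt; rewrite -h_x//.
  apply: is_derive_div; first exact: u0.
    exact: is_derive_dspace sh Jt.
  exact: is_derive_dspace su Jt.
have h_t t x : J t -> dtime h t x =
    2 * dtime u t x * h t x / u t x - dspace 0 u t x * h t x ^+ 2 / u t x ^+ 2.
  move=> Jt.
  have Dq := is_deriveM (dq t x Jt) (dq t x Jt).
  (* The codifferential terms differentiate the square of h/u, so the product rule reduces them to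
     [dq], which also yields the second form of the variation formula. *)
  have qE : (fun y => h t y ^+ 2 / u t y ^+ 2) =
      (fun y => h t y / u t y) * (fun y => h t y / u t y).
    by apply/funext => y; rewrite fctE; field; exact: u0.
  (* Reading d alpha off the time derivative of omega_3 gives the whole 2-form at once, without the
     derivatives of h in the directions x^1 and x^2. *)
  have dh : ext_deriv (fun y => h t y *: dx R 3) x = dtime u t x *: base R (Defs.mset 4 m1001).
    by rewrite -alphaE// -dt_omega3// (dt_omega3E _ _ _ _ _ (is_derive_dtime _ _ _ _ x su Jt)).
  have := congr1 (fun a : ext R 4 => a [set 3]%SET) (geodesic t Jt x).
  rewrite /= ext_scaleE alphaE//.
  rewrite (geodesic_rhs3 (u t) (h t) x (dtime u t x)) => //; first last.
  - by rewrite qE; have [] := Dq.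
  - by move=> y; exact: u_gt0.
  have -> : dt alpha t x [set 3]%SET = dtime h t x.
    rewrite ffunE /dt_fun derive1E.
    by have [_ ->] := is_derive_dtime _ _ _ _ x sh Jt.
  rewrite qE /pderiv; have [_ ->] := Dq; rewrite /GRing.scale /= => H.
  have : 6 * dtime h t x = 6 * (2 * dtime u t x * h t x / u t x -
      dspace 0 u t x * h t x ^+ 2 / u t x ^+ 2).
    by rewrite H; field; exact: u0.
  by apply: mulfI; rewrite pnatr_eq0.
have VE t : J t -> V t = cube_int (fun p : 'rV[R]_7 => u t (xpart p) `^ (1 / 3)).
  move=> Jt; rewrite /V /Vol /torus_int; congr cube_int; apply/funext => p.
  by rewrite -[vol_form _ _]scale1r top_vol_phi ?mul1r//; exact: u_gt0.
clearbody V.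
pose V1 t := cube_int (fun p : 'rV[R]_7 => vol_dt u t (xpart p)).
pose V2 t := cube_int (fun p : 'rV[R]_7 => vol_dtt u t (xpart p)).
have dV t : J t -> is_derive t (1 : R) V (V1 t).
  (* The density of the volume form is u^{1/3} only where u > 0, that is for times in [J]; since [J]
     is open, this is enough to differentiate [V] there. *)
  move=> Jt; apply: (@near_eq_is_derive _ _ _
    (fun t => cube_int (fun p : 'rV[R]_7 => u t (xpart p) `^ (1 / 3)))).
    by near=> s; rewrite VE//; near: s; exact: open_nbhs_nbhs.
  apply: (is_derive_cube_int 7 J (fun t p => u t (xpart p) `^ (1 / 3))
    (fun t p => vol_dt u t (xpart p))) => //.
  - move=> s Js; apply: (continuous2_xpart (fun s x => u s x `^ (1 / 3))).
    apply: continuous2_powR; first by move=> x; exact: u_gt0.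
    exact: smooth_path_continuous2 su _ Js.
  - move=> s Js; apply: (continuous2_xpart (vol_dt u)).
    exact: (continuous2_vol_dt J u su u_gt0 s Js).
  - by move=> s p Js; exact: (is_derive_vol J u su u_gt0 s _ Js).
have dV1 t : J t -> is_derive t (1 : R) V1 (V2 t).
  apply: (is_derive_cube_int 7 J (fun t p => vol_dt u t (xpart p))
    (fun t p => vol_dtt u t (xpart p))) => //.
  - move=> s Js; apply: (continuous2_xpart (vol_dt u)).
    exact: (continuous2_vol_dt J u su u_gt0 s Js).
  - move=> s Js; apply: (continuous2_xpart (vol_dtt u)).
    exact: (continuous2_vol_dtt J u su u_gt0 s Js).
  - by move=> s p Js; exact: (is_derive_vol_dt J u su u_gt0 s _ Js).
have ph t : J t -> torus_periodic (h t) by move=> Jt; exact: alpha_periodic.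
have V2E t : J t -> 9 * V2 t = - 2 * cube_int (fun p : 'rV[R]_7 => let x := xpart p in
    ((u t x)^-1 * dtime u t x - u t x ^- 2 * dspace 0 u t x * h t x) ^+ 2 * u t x `^ (1 / 3)).
  by move=> Jt; exact: (cube_int_vol_dtt J u h openJ su sh u_gt0 u_periodic ph h_x h_t t Jt).
have dV' t : J t -> is_derive t (1 : R) (derive1 V) (V2 t).
  move=> Jt.
  have ne : \forall s \near t, V1 s = derive1 V s.
    near=> s; have Js : J s by near: s; exact: open_nbhs_nbhs.
    by rewrite derive1E; have [_ ->] := dV s Js.
  exact: near_eq_is_derive ne (dV1 t Jt).
clearbody V1 V2.
split; last first.
  apply: (concave_second_derivative J V V1 V2 intervalJ dV dV1) => t Jt.
  (* Concavity is the sign in the variation formula: the integrand is a square times u^{1/3}, so 9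
     [V2 t] is -2 times a nonnegative number. *)
  have := V2E t Jt; set I := cube_int _ => E.
  have : 0 <= I.
    by apply: cube_int_ge0 => p /=; rewrite mulr_ge0 ?powR_ge0// sqr_ge0.
  by move: E; lra.
move=> t Jt; have [V_d _] := dV t Jt; have [V'_d V'E] := dV' t Jt.
have V''E : derive1n 2 V t = V2 t by rewrite derive1nS derive1n1 derive1E.
split; [exact: V_d|exact: V'_d| |];
  rewrite V''E (V2E t Jt) /torus_int; congr (_ * cube_int _); apply/funext => p /=.
  rewrite top_vol_phi; last exact: u_gt0.
  by rewrite dtuE; [rewrite dxuE|].
rewrite top_vol_phi; last exact: u_gt0.
rewrite /pderiv; have [_ ->] := dq t (xpart p) Jt; congr (_ ^+ 2 * _).
by field; exact: u0.
Unshelve. all: by end_near. Qed.
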